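(* The steady rotations of the 3D Veselova top about the largest and smallest principal axes of inertia are Lyapunov stable ($\mathrm{O}(2)$-Lyapunov stable in the case of axisymmetric tops).
   Context: Let $\mathbb{J}=\mathrm{diag}[J_1,J_2,J_3]$ with all $J_i>0$. $T^*\mathrm{S}^{2}=\{(q,p)\in\mathbb{R}^3\times\mathbb{R}^3:\|q\|=1,\ q\cdot p=0\}$. The reduced 3D Veselova system is $$\dot q=C\left[p-\frac{p\cdot Cq}{q\cdot Cq}q\right],\quad \dot p=-2H(q,p)q,\quad C=(\mathbb{J}+(q\cdot\mathbb{J}q)\mathrm{Id}_3)^{-1},\quad H(q,p)=\tfrac12\left(p\cdot Cp-\tfrac{(p\cdot Cq)^2}{q\cdot Cq}\right).$$ A steady rotation is a solution along which $\Omega=q\dot q^T-\dot q q^T$ is constant and nonzero; then $q(t),p(t)$ rotate uniformly in a 2-dimensional $\mathbb{J}$-invariant plane. The steady rotation is about the principal axis orthogonal to that plane. The principal moment of inertia about a principal axis (eigendirection of $\mathbb{J}$) is the sum of the eigenvalues of $\mathbb{J}$ restricted to the orthogonal plane; for the $i$-th coordinate axis it is $J_j+J_k$, $\{i,j,k\}=\{1,2,3\}$. Largest/smallest refers to this moment. The top is axisymmetric if exactly two of the $J_i$ coincide; then $\mathrm{O}(2)$ denotes the group of orthogonal transformations of $\mathbb{R}^3$ fixing the symmetry axis (the eigendirection of the simple eigenvalue), acting diagonally on $(q,p)$. A compact subset $S$ of the phase space is Lyapunov stable if for each neighbourhood $U$ of $S$ there is a neighbourhood $V$ of $S$ such that any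 trajectory entering $V$ lies entirely in $U$; a steady rotation is Lyapunov stable if its trajectory is. For a group $K$ of symmetries, a $K$-invariant set $S$ is $K$-Lyapunov stable if this holds with $U$ and $V$ restricted to $K$-invariant neighbourhoods; a steady rotation is $K$-Lyapunov stable if the $K$-orbit of its trajectory is. *)

(* Defs.v *)
From HB Require Import structures.
From mathcomp Require Import all_boot all_order all_algebra.
From mathcomp Require Import all_classical all_reals all_analysis.

Set Implicit Arguments.
Unset Strict Implicit.
Unset Printing Implicit Defensive.

Import Order.TTheory GRing.Theory Num.Theory.
Import numFieldNormedType.Exports.

Local Open Scope classical_set_scope.
Local Open Scope ring_scope.

Definition dot (R : realType) (u v : 'cV[R]_3) : R := (u^T *m v) 0 0.

Definition cotangent_sphere (R : realType) : set ('cV[R]_3 * 'cV[R]_3) :=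
  [set x | dot x.1 x.1 = 1 /\ dot x.1 x.2 = 0].
Arguments cotangent_sphere : clear implicits.

(* The inertia tensor diag[J_1, J_2, J_3] is [diag_mx J], where [J] is the row
   vector of its diagonal entries. *)
Definition veselova_C (R : realType) (J : 'rV[R]_3) (q : 'cV[R]_3) : 'M[R]_3 :=
  invmx (diag_mx J + (dot q (diag_mx J *m q))%:M).

Definition veselova_H (R : realType) (J : 'rV[R]_3) (q p : 'cV[R]_3) : R :=
  let C := veselova_C J q in
  2^-1 * (dot p (C *m p) - dot p (C *m q) ^+ 2 / dot q (C *m q)).

Definition veselova_qdot (R : realType) (J : 'rV[R]_3) (q p : 'cV[R]_3) :
    'cV[R]_3 :=
  let C := veselova_C J q in
  C *m (p - (dot p (C *m q) / dot q (C *m q)) *: q).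

Definition veselova_pdot (R : realType) (J : 'rV[R]_3) (q p : 'cV[R]_3) :
    'cV[R]_3 :=
  - (2 * veselova_H J q p) *: q.

Definition veselova_solution (R : realType) (J : 'rV[R]_3) (I : set R)
    (q p : R -> 'cV[R]_3) : Prop :=
  forall t, I t ->
    [/\ cotangent_sphere R (q t, p t),
        is_derive t 1 q (veselova_qdot J (q t) (p t)) &
        is_derive t 1 p (veselova_pdot J (q t) (p t))].

Definition Omega (R : realType) (q : R -> 'cV[R]_3) (t : R) : 'M[R]_3 :=
  q t *m (derive1 q t)^T - derive1 q t *m (q t)^T.

Definition steady_rotation (R : realType) (J : 'rV[R]_3)
    (q p : R -> 'cV[R]_3) : Prop :=
  veselova_solution J setT q p /\
  exists2 W : 'M[R]_3, W != 0 & forall t, Omega q t = W.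

(* An axis is represented by a nonzero vector [n] spanning it.  For nonzero [n],
   a steady rotation leaves no freedom: [q] sweeps out a full circle, so the
   plane orthogonal to [n] is the plane of the motion. *)
Definition rotates_about (R : realType) (n : 'cV[R]_3)
    (q p : R -> 'cV[R]_3) : Prop :=
  forall t, dot n (q t) = 0 /\ dot n (p t) = 0.

Definition principal_axis (R : realType) (J : 'rV[R]_3) (n : 'cV[R]_3) : Prop :=
  n != 0 /\ exists a : R, diag_mx J *m n = a *: n.

(* [m] is the sum of the eigenvalues, with multiplicity, of [diag_mx J]
   restricted to the plane orthogonal to the principal axis [n]; [u], [v] is an
   orthogonal eigenbasis of that plane. *)
Definition principal_moment (R : realType) (J : 'rV[R]_3) (n : 'cV[R]_3)
    (m : R) : Prop :=
  exists (u v : 'cV[R]_3) (a b : R),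
    [/\ u != 0 /\ v != 0,
        [/\ dot n u = 0, dot n v = 0 & dot u v = 0],
        diag_mx J *m u = a *: u,
        diag_mx J *m v = b *: v &
        m = a + b].

Definition largest_principal_axis (R : realType) (J : 'rV[R]_3)
    (n : 'cV[R]_3) : Prop :=
  principal_axis J n /\
  exists2 m, principal_moment J n m &
    forall n' m', principal_axis J n' -> principal_moment J n' m' -> m' <= m.

Definition smallest_principal_axis (R : realType) (J : 'rV[R]_3)
    (n : 'cV[R]_3) : Prop :=
  principal_axis J n /\
  exists2 m, principal_moment J n m &
    forall n' m', principal_axis J n' -> principal_moment J n' m' -> m <= m'.

(* Exactly two of the three entries coincide; the remaining one, of index [k],
   is the simple eigenvalue, so the symmetry axis is the [k]-th coordinate
   axis. *)
Definition symmetry_index (R : realType) (J : 'rV[R]_3) (k : 'I_3) : Prop :=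
  exists i j : 'I_3,
    [/\ i != j, i != k, j != k, J 0 i = J 0 j & J 0 i != J 0 k].

Definition axisymmetric (R : realType) (J : 'rV[R]_3) : Prop :=
  exists k, symmetry_index J k.

(* The axis is fixed pointwise: fixing it only as a line would give a copy of
   O(2) x Z/2 instead of O(2). *)
Definition O2 (R : realType) (k : 'I_3) : set 'M[R]_3 :=
  [set g | g^T *m g = 1%:M /\ g *m delta_mx k 0 = delta_mx k 0 :> 'cV[R]_3].
Arguments O2 : clear implicits.

Definition diag_act (R : realType) (g : 'M[R]_3) (x : 'cV[R]_3 * 'cV[R]_3) :
    'cV[R]_3 * 'cV[R]_3 :=
  (g *m x.1, g *m x.2).

Definition invariant_set (R : realType) (K : set 'M[R]_3)
    (A : set ('cV[R]_3 * 'cV[R]_3)) : Prop :=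
  forall g x, K g -> A x -> A (diag_act g x).

Definition trajectory (R : realType) (q p : R -> 'cV[R]_3) :
    set ('cV[R]_3 * 'cV[R]_3) :=
  range (fun t => (q t, p t)).

Definition group_orbit (R : realType) (K : set 'M[R]_3)
    (A : set ('cV[R]_3 * 'cV[R]_3)) : set ('cV[R]_3 * 'cV[R]_3) :=
  [set y | exists g x, [/\ K g, A x & y = diag_act g x]].

(* Neighbourhoods for the topology that the phase space inherits from
   R^3 x R^3. *)
Definition phase_nbhs (R : realType) (S U : set ('cV[R]_3 * 'cV[R]_3)) : Prop :=
  exists2 O : set ('cV[R]_3 * 'cV[R]_3), set_nbhs S O &
    U = O `&` cotangent_sphere R.

(* Solutions on arbitrary open intervals are considered, so that completeness of
   the vector field is not presupposed; "lies entirely in U" refers to all times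
   of the interval, before as well as after the entrance time [t0]. *)
Definition confines (R : realType) (J : 'rV[R]_3)
    (V U : set ('cV[R]_3 * 'cV[R]_3)) : Prop :=
  forall (I : set R) (q p : R -> 'cV[R]_3),
    open I -> is_interval I -> veselova_solution J I q p ->
    forall t0, I t0 -> V (q t0, p t0) -> forall t, I t -> U (q t, p t).

Definition Lyapunov_stable (R : realType) (J : 'rV[R]_3)
    (S : set ('cV[R]_3 * 'cV[R]_3)) : Prop :=
  [/\ compact S, S `<=` cotangent_sphere R &
      forall U, phase_nbhs S U ->
      exists2 V, phase_nbhs S V & confines J V U].

Definition group_Lyapunov_stable (R : realType) (J : 'rV[R]_3)
    (K : set 'M[R]_3) (S : set ('cV[R]_3 * 'cV[R]_3)) : Prop :=
  [/\ compact S, S `<=` cotangent_sphere R, invariant_set K S &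
      forall U, phase_nbhs S U -> invariant_set K U ->
      exists V, [/\ phase_nbhs S V, invariant_set K V & confines J V U]].

(* Main.v *)
Require Import Defs.
From mathcomp Require Import all_boot all_order all_algebra.
From mathcomp Require Import all_classical all_reals all_analysis.
From mathcomp Require Import ring lra.

Import Order.TTheory GRing.Theory Num.Theory.
Import numFieldNormedType.Exports.

Set Implicit Arguments.
Unset Strict Implicit.
Unset Printing Implicit Defensive.

Local Open Scope classical_set_scope.
Local Open Scope ring_scope.

(** Write I_i for the moment of the i-th coordinate axis.  On the cotangent bundle
    of the sphere the position-dependent matrix C can be eliminated from the
    energy:

      2 H = (sum_i I_i p_i^2) / (sum_i I_j I_k q_i^2),   {i, j, k} = {1, 2, 3}

    ([double_veselova_H]), and the velocity of q takes the form of an explicit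
    rotation ([veselova_qdotE]).  Both H and |p|^2 are conserved
    ([is_derive_energy], [is_derive_momentum]).

    Rotations about the i-th axis have 2 H = |p|^2 / I_i.  With m = q x p, the
    identity

      I_i (sum_l I_l p_l^2) - |p|^2 (sum_l I_l' I_l'' q_l^2)
        = (I_i - I_k) (I_i p_i^2 + I_j |p|^2 q_i^2) + I_i (I_k - I_j) m_j^2

    ([critical_identity], where l, l', l'' are the three indices) shows that an
    extremal I_i makes these rotations an extremum of H for fixed |p|, and it
    identifies the level set through them:
    - if I_i is strictly extremal, it is q_i = p_i = 0, that is, the two
      directions of rotation in one plane;
    - if I_i is one of exactly two equal moments, it is the set of states whose
      plane, spanned by q and p, contains the symmetry axis.

    Compactness of the levels turns a conserved function with zero set S into a
    basis of invariant neighbourhoods of S ([tube_criterion]).  With all eigenvalues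
    distinct, the two directions of rotation are disjoint compact sets, and a
    trajectory near one of them cannot pass to the other
    ([strict_extremum_stable]).  For an axisymmetric top every principal axis has
    an extremal moment; an element of O(2) relates any two states with the same
    |p| and the same coordinates of q and p along the symmetry axis
    ([O2_connects]), so the level set is exactly the group orbit of the trajectory
    ([symmetry_axis_stable], [equatorial_axis_stable]).  With all eigenvalues equal,
    the moments do not separate the steady rotations, but q x p is then conserved as
    a vector ([spherical_stable]).

    A steady rotation is shown to run through a full great circle at constant
    speed ([steady_circular]), so that its trajectory is all of
    the states with a given q x p ([steady_trajectory]). *)

(** * Cyclic indices *)

Lemma ord3P (i : 'I_3) : [\/ i = 0, i = 1 | i = 2].
Proof.
case: i => [[|[|[|//]]]] h; [apply: Or31|apply: Or32|apply: Or33]; exact/val_inj.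
Qed.

Lemma ord3_add : [/\ (1 + 1 = 2 :> 'I_3), (1 + 2 = 0 :> 'I_3), (2 + 1 = 0 :> 'I_3),
  (2 + 2 = 1 :> 'I_3) & (0 + 1 = 1 :> 'I_3) /\ (0 + 2 = 2 :> 'I_3)].
Proof. by split; [| | | |split]; apply/val_inj. Qed.

Definition ord3_addE := (let: And5 a b c d (conj e f) := ord3_add in (a, b, c, d, e, f)).

Lemma sum3 (R : nmodType) (f : 'I_3 -> R) (i : 'I_3) :
  \sum_j f j = f i + f (i + 1) + f (i + 2).
Proof.
have -> : \sum_j f j = f 0 + f 1 + f 2.
  rewrite !big_ord_recl big_ord0 addr0 addrA.
  by congr (f _ + f _ + f _); apply/val_inj.
have [->|->|->] := ord3P i; rewrite ?ord3_addE //.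
- by rewrite -addrA addrC.
- by rewrite addrC addrA.
Qed.

Lemma ord3_cyc (i : 'I_3) :
  [/\ i + 1 + 1 = i + 2, i + 1 + 2 = i, i + 2 + 1 = i & i + 2 + 2 = i + 1].
Proof. by have [->|->|->] := ord3P i; rewrite !ord3_addE. Qed.

Lemma ord3_others (i j k : 'I_3) : i != j -> i != k -> j != k ->
  (j = i + 1 /\ k = i + 2) \/ (j = i + 2 /\ k = i + 1).
Proof.
have [->|->|->] := ord3P i; have [->|->|->] := ord3P j; have [->|->|->] := ord3P k;
  rewrite ?ord3_addE ?eqxx => // _ _ _; by [left|right].
Qed.

Lemma ord3_cyc_neq (i : 'I_3) : [/\ i != i + 1, i != i + 2 & i + 1 != i + 2].
Proof. by have [->|->|->] := ord3P i; rewrite !ord3_addE. Qed.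

(** * Vector algebra in dimension three *)

Section vector_algebra.
Variable R : realType.
Implicit Types (q p u v w z : 'cV[R]_3) (J : 'rV[R]_3) (i : 'I_3).

Lemma dotE u v : dot u v = \sum_i u i 0 * v i 0.
Proof. by rewrite /dot mxE; apply: eq_bigr => i _; rewrite mxE. Qed.

Lemma dot3 u v i :
  dot u v = u i 0 * v i 0 + u (i + 1) 0 * v (i + 1) 0 + u (i + 2) 0 * v (i + 2) 0.
Proof. by rewrite dotE (sum3 _ i). Qed.

Lemma dotC u v : dot u v = dot v u.
Proof. by rewrite !dotE; apply: eq_bigr => i _; rewrite mulrC. Qed.

Lemma dotZl a u v : dot (a *: u) v = a * dot u v.
Proof. by rewrite /dot linearZ /= -scalemxAl mxE. Qed.

Lemma dotZr a u v : dot u (a *: v) = a * dot u v.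
Proof. by rewrite dotC dotZl dotC. Qed.

Lemma dotDl u v w : dot (u + v) w = dot u w + dot v w.
Proof. by rewrite /dot linearD /= mulmxDl mxE. Qed.

Lemma dotDr u v w : dot w (u + v) = dot w u + dot w v.
Proof. by rewrite dotC dotDl !(dotC w). Qed.

Lemma dotBr u v w : dot w (u - v) = dot w u - dot w v.
Proof. by rewrite /dot mulmxBr !mxE. Qed.

Lemma dot_eq0 v : dot v v = 0 -> v = 0.
Proof.
rewrite dotE; under eq_bigr do rewrite -expr2.
move=> h; apply/colP => i; rewrite mxE; apply/eqP; rewrite -sqrf_eq0.
by have /(_ i isT)/eqP := @psumr_eq0P _ _ _ _ (fun j _ => sqr_ge0 (v j 0)) h.
Qed.

Lemma dot_gt0 v : dot v v != 0 -> 0 < dot v v.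
Proof.
move=> v0; rewrite lt_neqAle eq_sym v0 dotE sumr_ge0 // => i _.
by rewrite -expr2 sqr_ge0.
Qed.

Definition cross u v : 'cV[R]_3 :=
  \col_i (u (i + 1) 0 * v (i + 2) 0 - u (i + 2) 0 * v (i + 1) 0).

(** On the i-th coordinate axis this is the principal moment: the sum of the
    two eigenvalues with the other indices. *)
Definition moment J i : R := J 0 (i + 1) + J 0 (i + 2).

Definition inertia_form J p : R := \sum_i moment J i * p i 0 ^+ 2.

(** With I the diagonal tensor of the principal moments, this is q . adj(I) q,
    that is, det(I) (q . I^-1 q). *)
Definition adjugate_form J q : R :=
  \sum_i moment J (i + 1) * moment J (i + 2) * q i 0 ^+ 2.

(** On the cotangent bundle of the sphere this rational function, with the shift
    q . J q eliminated, is 2 H; see [double_veselova_H]. *)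
Definition double_energy J (x : 'cV[R]_3 * 'cV[R]_3) : R :=
  inertia_form J x.2 / adjugate_form J x.1.

Local Notation phase := (cotangent_sphere R).

Lemma axis_coord_neq0 (w : 'cV[R]_3) i :
  w != 0 -> (forall j, j != i -> w j 0 = 0) -> w i 0 != 0.
Proof.
move=> w0 wj; apply: contra w0 => /eqP wi; apply/eqP/colP => j; rewrite mxE.
by have [->|/wj] := eqVneq j i.
Qed.

Lemma dot_axis (w v : 'cV[R]_3) i :
  (forall j, j != i -> w j 0 = 0) -> dot w v = w i 0 * v i 0.
Proof.
by move=> wj; rewrite dotE (bigD1 i) //= big1 ?addr0 // => j /wj ->; rewrite mul0r.
Qed.

Lemma coord_plane_cross i (u v : 'cV[R]_3) : u i 0 = 0 -> v i 0 = 0 ->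
  forall j, j != i -> cross u v j 0 = 0.
Proof.
move=> ui vi j; have [e1 e2 e3 e4] := ord3_cyc i.
move: (ord3_cyc_neq i) => [n1 n2 n3]; rewrite mxE.
have [->|ji] := eqVneq j (i + 1).
  by rewrite e1 e2 ui vi mulr0 mul0r subrr.
have [->|jj] := eqVneq j (i + 2).
  by rewrite e3 e4 ui vi mulr0 mul0r subrr.
rewrite eq_sym => ij; have [[h _]|[h _]] := ord3_others ij n2 jj.
  by rewrite h eqxx in ji.
by rewrite h eqxx in jj.
Qed.

(** The vectors q, p / |p|, (q x p) / |p| form an orthonormal basis, so the
    squares of their i-th coordinates add up to 1; this is that relation,
    multiplied by |p|^2. *)
Lemma cross_sqr q p i : phase (q, p) ->
  cross q p i 0 ^+ 2 = dot p p - p i 0 ^+ 2 - dot p p * q i 0 ^+ 2.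
Proof.
rewrite /cotangent_sphere /= => -[q1 qp].
rewrite mxE; move: q1 qp; rewrite !(dot3 _ _ i).
set a := q i 0; set b := q (i + 1) 0; set c := q (i + 2) 0.
set x := p i 0; set y := p (i + 1) 0; set z := p (i + 2) 0.
move=> q1 qp.
have -> : (b * z - c * y) ^+ 2 =
  (b * b + c * c) * (y * y + z * z) - (b * y + c * z) ^+ 2 by ring.
have -> : b * b + c * c = 1 - a ^+ 2 by rewrite -q1; ring.
have -> : b * y + c * z = - (a * x) by apply/eqP; rewrite -subr_eq0 -qp; apply/eqP; ring.
ring.
Qed.

Lemma dot_cross q p : phase (q, p) -> dot (cross q p) (cross q p) = dot p p.
Proof.
move=> h; rewrite [LHS]dotE.
under eq_bigr do rewrite -expr2 cross_sqr //.
rewrite (sum3 _ 0); case: h => /=; rewrite !(dot3 _ _ 0) => q1 _; nra.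
Qed.

Lemma cross_dotl q p : dot (cross q p) q = 0.
Proof. by rewrite (dot3 _ _ 0) !mxE !ord3_addE; ring. Qed.

Lemma cross_dotr q p : dot (cross q p) p = 0.
Proof. by rewrite (dot3 _ _ 0) !mxE !ord3_addE; ring. Qed.

Lemma cross_crossK q p : phase (q, p) -> cross (cross q p) q = p.
Proof.
move=> [/= q1 qp].
have h i : cross (cross q p) q i 0 = dot q q * p i 0 - dot q p * q i 0.
  by have [->|->|->] := ord3P i; rewrite !(dot3 _ _ 0) !mxE ?ord3_addE; ring.
by apply/colP => i; rewrite h q1 qp mul1r mul0r subr0.
Qed.

(** Expansion in a basis q, p, m by means of its dual basis; it is an identity of
    polynomials, so q and p need not be independent. *)
Lemma cross_dual_expansion q p z :
  let m := cross q p in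
  dot m m *: z = dot z (cross p m) *: q + dot z (cross m q) *: p + dot z m *: m.
Proof.
move=> m; rewrite {}/m; apply/colP => i.
by have [->|->|->] := ord3P i;
  rewrite !mxE !(dot3 _ _ 0); do 3?rewrite ?mxE ?ord3_addE; ring.
Qed.

Lemma cross_pcross q p : phase (q, p) -> cross p (cross q p) = dot p p *: q.
Proof.
move=> [/= _ qp].
have h i : cross p (cross q p) i 0 = dot p p * q i 0 - dot q p * p i 0.
  by have [->|->|->] := ord3P i; rewrite !(dot3 _ _ 0); do 3?rewrite ?mxE ?ord3_addE; ring.
by apply/colP => i; rewrite h qp mul0r subr0 mxE.
Qed.

Lemma frame_expansion q p z : phase (q, p) -> dot p p != 0 ->
  z = dot z q *: q + (dot z p / dot p p) *: p
      + (dot z (cross q p) / dot p p) *: cross q p.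
Proof.
move=> qp p0; apply: (scalerI p0).
rewrite -{1}(dot_cross qp) cross_dual_expansion cross_pcross // cross_crossK //.
rewrite dotZr !scalerDr !scalerA; congr (_ *: _ + _ *: _ + _ *: _); by field.
Qed.

End vector_algebra.

(** * The vector field in closed form *)

Section vector_field.
Variables (R : realType) (J : 'rV[R]_3).
Hypothesis J_gt0 : forall i, 0 < J 0 i.
Implicit Types (q p u v w : 'cV[R]_3) (i : 'I_3).
Local Notation phase := (cotangent_sphere R).

Lemma moment_gt0 i : 0 < moment J i.
Proof. by rewrite addr_gt0. Qed.

Lemma weighted_sqr_gt0 (w : 'I_3 -> R) q :
  (forall i, 0 < w i) -> dot q q != 0 -> 0 < \sum_i w i * q i 0 ^+ 2.
Proof.
move=> w0 q0; have ge0 i : 0 <= w i * q i 0 ^+ 2 by rewrite mulr_ge0 ?sqr_ge0 // ltW.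
rewrite lt_neqAle sumr_ge0 // andbT eq_sym; apply: contra q0 => /eqP S0.
rewrite dotE big1 // => i _.
have /(_ i isT)/eqP := @psumr_eq0P _ _ _ _ (fun j _ => ge0 j) S0.
by rewrite mulf_eq0 gt_eqF //= sqrf_eq0 => /eqP ->; rewrite mul0r.
Qed.

Lemma adjugate_form_gt0 q : dot q q != 0 -> 0 < adjugate_form J q.
Proof. by apply: weighted_sqr_gt0 => i; rewrite mulr_gt0 ?moment_gt0. Qed.

Lemma inertia_form_gt0 p : dot p p != 0 -> 0 < inertia_form J p.
Proof. by apply: weighted_sqr_gt0 => i; rewrite moment_gt0. Qed.

(** The diagonal of the inverse of the matrix C. *)
Definition shifted_inertia q i : R := J 0 i + \sum_j J 0 j * q j 0 ^+ 2.

Lemma shifted_inertia_gt0 q i : 0 < shifted_inertia q i.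
Proof.
rewrite ltr_wpDr //; apply: sumr_ge0 => j _.
by rewrite mulr_ge0 ?sqr_ge0 // ltW.
Qed.

Lemma veselova_CE q v i : (veselova_C J q *m v) i 0 = v i 0 / shifted_inertia q i.
Proof.
have E : diag_mx J + (dot q (diag_mx J *m q))%:M = diag_mx (\row_i shifted_inertia q i).
  apply/matrixP => a b; rewrite !mxE; case: eqP => [->|_]; last by rewrite !mulr0n addr0.
  rewrite !mulr1n /shifted_inertia dotE; congr (_ + _).
  by apply: eq_bigr => j _; rewrite mul_diag_mx mxE; ring.
have V : veselova_C J q = diag_mx (\row_i (shifted_inertia q i)^-1).
  rewrite /veselova_C E.
  have K : diag_mx (\row_i (shifted_inertia q i)^-1) *m
           diag_mx (\row_i shifted_inertia q i) = 1%:M.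
    rewrite mulmx_diag; apply/matrixP => a b; rewrite !mxE.
    by case: eqP => // _; rewrite mulVf // gt_eqF ?shifted_inertia_gt0.
  have [_ U] := mulmx1_unit K.
  by rewrite -[RHS]mulmx1 -(mulmxV U) mulmxA K mul1mx.
by rewrite V mul_diag_mx !mxE mulrC.
Qed.

(** The left-hand side is q . adj(C^-1) q.  The shift enters it quadratically, but
    for a unit vector q the definition of the shift turns it into the adjugate
    of the principal moments. *)
Lemma shifted_adjugate q : dot q q = 1 ->
  \sum_i shifted_inertia q (i + 1) * shifted_inertia q (i + 2) * q i 0 ^+ 2 =
  adjugate_form J q.
Proof.
rewrite /adjugate_form /shifted_inertia /moment (dot3 _ _ 0) !(sum3 _ 0) !ord3_addE => q1.
have -> : q 2 0 ^+ 2 = 1 - q 0 0 ^+ 2 - q 1 0 ^+ 2 by rewrite -q1; ring.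
ring.
Qed.

(** The quadratic form of C^-1 on q x p.  By [cross_sqr] the contribution of q to
    each square cancels the shift. *)
Lemma shifted_inertia_cross q p : phase (q, p) ->
  \sum_i shifted_inertia q i * cross q p i 0 ^+ 2 = inertia_form J p.
Proof.
move=> qp; under eq_bigr do rewrite cross_sqr //.
case: qp => /= + _; rewrite /inertia_form /shifted_inertia /moment !(dot3 _ _ 0).
rewrite !(sum3 _ 0) !ord3_addE => q1.
have -> : q 2 0 ^+ 2 = 1 - q 0 0 ^+ 2 - q 1 0 ^+ 2 by rewrite -q1; ring.
ring.
Qed.

(** This is C^-1 (q x p); divided by [adjugate_form] it is the angular velocity
    of the motion of q. *)
Definition scaled_angular_velocity q p : 'cV[R]_3 :=
  \col_i (shifted_inertia q i * cross q p i 0).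

Lemma dot_veselova_CE u v q : dot u (veselova_C J q *m v) =
  \sum_i u i 0 * v i 0 / shifted_inertia q i.
Proof. by rewrite dotE; apply: eq_bigr => i _; rewrite veselova_CE mulrA. Qed.

Lemma dot_veselova_C q : dot q q = 1 ->
  dot q (veselova_C J q *m q) =
  adjugate_form J q / (shifted_inertia q 0 * shifted_inertia q 1 * shifted_inertia q 2).
Proof.
move=> q1; rewrite -shifted_adjugate // dot_veselova_CE !(sum3 _ 0) !ord3_addE.
have c0 i : shifted_inertia q i != 0 by rewrite gt_eqF ?shifted_inertia_gt0.
by field; rewrite !c0.
Qed.

(** The cofactor identity (C p) x (C q) = det(C) C^-1 (p x q), crossed with q,
    turns the projected velocity into a rotation of q, and the normalization
    q . C q becomes the denominator [adjugate_form]. *)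
Lemma veselova_qdotE q p : phase (q, p) ->
  veselova_qdot J q p = (adjugate_form J q)^-1 *: cross (scaled_angular_velocity q p) q.
Proof.
move=> [/= q1 qp].
have D0 : 0 < adjugate_form J q by rewrite adjugate_form_gt0 // q1 oner_eq0.
rewrite /veselova_qdot.
have c0 i : shifted_inertia q i != 0 by rewrite gt_eqF ?shifted_inertia_gt0.
have qCq := dot_veselova_C q1; apply/colP => i.
rewrite veselova_CE !mxE !dot_veselova_CE in qCq *.
move: qCq; rewrite !(sum3 _ 0) !ord3_addE => qCq; rewrite qCq.
have DE : adjugate_form J q =
    (q 0 0 * q 0 0 / shifted_inertia q 0 + q 1 0 * q 1 0 / shifted_inertia q 1
     + q 2 0 * q 2 0 / shifted_inertia q 2)
    * (shifted_inertia q 0 * shifted_inertia q 1 * shifted_inertia q 2).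
  by rewrite qCq divfK // !mulf_neq0.
have D1 : adjugate_form J q != 0 by rewrite gt_eqF.
apply: (mulfI D1).
have -> a b : adjugate_form J q *
    ((p i 0 - a / (adjugate_form J q / b) * q i 0) / shifted_inertia q i) =
    (adjugate_form J q * p i 0 - a * b * q i 0) / shifted_inertia q i.
  have [->|b0] := eqVneq b 0; last by field; rewrite D1 b0 c0.
  by rewrite invr0 mulr0 invr0; ring.
rewrite mulVKf // DE.
by have [->|->|->] := ord3P i; rewrite ?ord3_addE; field; rewrite !c0.
Qed.

Lemma dot_qdot q p : phase (q, p) ->
  dot p (veselova_qdot J q p) = double_energy J (q, p).
Proof.
move=> qp; rewrite veselova_qdotE // dotZr /double_energy mulrC; congr (_ / _).
rewrite -(shifted_inertia_cross qp) !(dot3 _ _ 0) !(sum3 _ 0) !mxE !ord3_addE; ring.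
Qed.

Lemma double_veselova_H q p : phase (q, p) ->
  2 * veselova_H J q p = double_energy J (q, p).
Proof.
move=> qp; rewrite -dot_qdot // /veselova_H /veselova_qdot mulrA divff ?pnatr_eq0 // mul1r.
rewrite mulmxBr -scalemxAr dotBr dotZr; ring.
Qed.

(** The identity behind the conservation of energy: the derivative of the
    denominator of [double_energy] along the flow compensates that of the
    numerator. *)
Lemma adjugate_qdot q p : phase (q, p) ->
  \sum_i moment J (i + 1) * moment J (i + 2) * q i 0 * veselova_qdot J q p i 0 =
  - \sum_i moment J i * q i 0 * p i 0.
Proof.
move=> qp; have [/= q1 _] := qp; rewrite veselova_qdotE //.
set D := adjugate_form J q.
have D0 : D != 0 by rewrite gt_eqF // adjugate_form_gt0 // q1 oner_eq0.
apply: (mulfI D0); rewrite mulr_sumr.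
have E i : D * (moment J (i + 1) * moment J (i + 2) * q i 0 *
    (D^-1 *: cross (scaled_angular_velocity q p) q) i 0) =
    moment J (i + 1) * moment J (i + 2) * q i 0 * cross (scaled_angular_velocity q p) q i 0.
  by rewrite [fun_of_matrix (_ *: _) _ _]mxE; field.
rewrite (eq_bigr _ (fun i _ => E i)).
have pE := cross_crossK qp; set m := cross q p in pE.
have -> : scaled_angular_velocity q p =
    \col_i ((J 0 i * dot q q + \sum_j J 0 j * q j 0 ^+ 2) * cross q (cross m q) i 0).
  by apply/colP => i; rewrite pE !mxE /shifted_inertia q1 mulr1.
rewrite -[RHS]mul1r -q1 -[in RHS]pE {D0 E}/D /adjugate_form /moment.
(* With p = m x q for a free vector m, both sides are polynomials in m and q,
   homogenized by |q|^2 = 1, and the identity holds without constraints. *)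
clearbody m.
rewrite !(dot3 _ _ 0) !(sum3 _ 0) ?ord3_addE; do 4?rewrite ?mxE ?ord3_addE.
ring.
Qed.
End vector_field.

(** * Derivatives and conserved quantities *)

Section derivatives.
Variables (R : realType) (J : 'rV[R]_3).
Hypothesis J_gt0 : forall i, 0 < J 0 i.
Implicit Types (q p u v w : 'cV[R]_3) (i : 'I_3).

Lemma is_derive_coord (f : R -> 'cV[R]_3) (t : R) df i :
  is_derive t 1 f df -> is_derive t 1 (fun s => f s i 0) (df i 0).
Proof.
move=> [f1 <-]; split; first by move/derivable_mxP : f1; exact.
by rewrite derive_mx // mxE.
Qed.

Lemma is_derive_dot (f g : R -> 'cV[R]_3) (t : R) df dg :
  is_derive t 1 f df -> is_derive t 1 g dg ->
  is_derive t 1 (fun s => dot (f s) (g s)) (dot df (g t) + dot (f t) dg).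
Proof.
move=> fd gd.
rewrite (_ : (fun s => _) = \sum_i ((fun s => f s i 0) * (fun s => g s i 0))); last first.
  by apply/funext => s; rewrite dotE fct_sumE.
have h i : is_derive t 1 ((fun s => f s i 0) * (fun s => g s i 0) : R -> R)
    (f t i 0 *: dg i 0 + g t i 0 *: df i 0).
  by apply: is_deriveM; exact: is_derive_coord.
apply: is_derive_eq; rewrite !dotE -big_split; apply: eq_bigr => i _ /=.
by rewrite /GRing.scale /=; ring.
Qed.

Lemma is_derive_weighted_sqr (w : 'I_3 -> R) (f : R -> 'cV[R]_3) (t : R) df :
  is_derive t 1 f df ->
  is_derive t 1 (fun s => \sum_i w i * f s i 0 ^+ 2)
    (2 * \sum_i w i * f t i 0 * df i 0).
Proof.
move=> fd.
rewrite (_ : (fun s => _) = \sum_i (w i *: ((fun s => f s i 0) ^+ 2))); last first.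
  by apply/funext => s; rewrite fct_sumE.
have h i : is_derive t 1 (fun s => f s i 0) (df i 0) by exact: is_derive_coord.
apply: is_derive_eq; rewrite mulr_sumr; apply: eq_bigr => i _ /=.
by rewrite /GRing.scale /=; ring.
Qed.

Lemma is_derive_div (f g : R -> R) (t df dg : R) : g t != 0 ->
  is_derive t 1 f df -> is_derive t 1 g dg ->
  is_derive t 1 (fun s => f s / g s) ((df * g t - f t * dg) / g t ^+ 2).
Proof.
move=> g0 fd [gd gE].
have gV : is_derive t 1 (fun s => (g s)^-1) (- (g t) ^- 2 *: dg).
  by split; [exact: derivableV | rewrite deriveV // gE].
apply: (is_derive_eq (is_deriveM fd gV)).
by rewrite /GRing.scale /=; field.
Qed.

Lemma derive0_cst (I : set R) (f : R -> R) :
  is_interval I -> (forall t, I t -> is_derive t 1 f 0) ->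
  forall s t, I s -> I t -> f s = f t.
Proof.
move=> Iitv f0 s t Is It.
wlog st : s t Is It / s <= t.
  by move=> H; have [/H|/ltW/H] := leP s t; [|move=> H'; apply/esym]; auto.
have sub x : x \in `[s, t] -> I x by rewrite in_itv /= => h; exact: Iitv h.
have [||c _] := @MVT_segment R f (fun=> 0) s t st.
- move=> x xst; apply: f0; apply: sub; exact: subset_itv_oo_cc xst.
- apply: derivable_within_continuous => x /sub Ix.
  by have [] := f0 x Ix.
- by rewrite mul0r => /eqP; rewrite subr_eq0 => /eqP.
Qed.

Variables (I : set R) (q p : R -> 'cV[R]_3).
Hypothesis sol : veselova_solution J I q p.

Lemma is_derive_p t : I t ->
  is_derive t 1 p (- (double_energy J (q t, p t)) *: q t).
Proof.
by move=> It; have [qp _] := sol It; rewrite /veselova_pdot double_veselova_H.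
Qed.

(** The force is parallel to q, hence orthogonal to p. *)
Lemma is_derive_momentum t : I t -> is_derive t 1 (fun s => dot (p s) (p s)) 0.
Proof.
move=> It; have pd := is_derive_p It; have [[_ /= qp] _ _] := sol It.
apply: (is_derive_eq (is_derive_dot pd pd)).
by rewrite dotZr dotZl (dotC (p t)) qp !mulr0 addr0.
Qed.

Lemma is_derive_energy t : I t ->
  is_derive t 1 (fun s => double_energy J (q s, p s)) 0.
Proof.
move=> It; have pd := is_derive_p It; have [qp qd _] := sol It.
have Dd := is_derive_weighted_sqr (fun i => moment J (i + 1) * moment J (i + 2)) qd.
have Nd := is_derive_weighted_sqr (moment J) pd.
have D0 : adjugate_form J (q t) != 0.
  by rewrite gt_eqF // adjugate_form_gt0 // (proj1 qp) oner_eq0.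
rewrite adjugate_qdot // in Dd.
apply: (is_derive_eq (is_derive_div D0 Nd Dd)).
rewrite -/(inertia_form J (p t)) -/(adjugate_form J (q t)).
set e := double_energy J _.
have -> : inertia_form J (p t) = e * adjugate_form J (q t) by rewrite /e /double_energy /= divfK.
rewrite (_ : \sum_i _ = - e * \sum_i moment J i * q t i 0 * p t i 0); last first.
  by rewrite mulr_sumr; apply: eq_bigr => i _; rewrite mxE; ring.
by field.
Qed.

End derivatives.

(** * Conserved functions and Lyapunov stability *)

Section topology.
Variables (R : realType).
Local Notation X := ('cV[R]_3 * 'cV[R]_3)%type.
Implicit Types (q p u v w : 'cV[R]_3) (i : 'I_3).
Local Notation phase := (cotangent_sphere R).

Lemma continuous_coord (f : X -> 'cV[R]_3) i :
  continuous f -> continuous (fun x => f x i 0).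
Proof.
move=> fc x; apply: (@continuous_comp _ _ _ f (fun v : 'cV[R]_3 => v i 0)).
  exact: fc.
exact: coord_continuous.
Qed.

Lemma continuous_sum3 (f : 'I_3 -> X -> R) :
  (forall i, continuous (f i)) -> continuous (fun x => \sum_i f i x).
Proof.
move=> fc; under eq_fun do rewrite (sum3 _ 0).
by move=> x; do 2?apply: cvgD; exact: fc.
Qed.

Lemma continuous_dot (f g : X -> 'cV[R]_3) :
  continuous f -> continuous g -> continuous (fun x => dot (f x) (g x)).
Proof.
move=> fc gc; under eq_fun do rewrite dotE.
apply: continuous_sum3 => i x.
by apply: cvgM; exact: continuous_coord.
Qed.

Lemma continuous_fst : continuous (fst : X -> 'cV[R]_3).
Proof. by move=> x; exact: cvg_fst. Qed.

Lemma continuous_snd : continuous (snd : X -> 'cV[R]_3).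
Proof. by move=> x; exact: cvg_snd. Qed.

Lemma continuous_cross i : continuous (fun x : X => cross x.1 x.2 i 0).
Proof.
under eq_fun do rewrite mxE.
have c1 j := @continuous_coord fst j continuous_fst.
have c2 j := @continuous_coord snd j continuous_snd.
by move=> x; apply: cvgB; apply: cvgM; [exact: c1|exact: c2|exact: c1|exact: c2].
Qed.

Lemma derivable_continuous (f : R -> 'cV[R]_3) (s : R) :
  derivable f s 1 -> {for s, continuous f}.
Proof. by move=> /derivable1_diffP/differentiable_continuous. Qed.

Lemma compact_box (c : R) : compact [set v : 'cV[R]_3 | forall i, v i 0 \in `[- c, c]].
Proof.
have -> : [set v : 'cV[R]_3 | forall i, v i 0 \in `[- c, c]] =
    trmx @` [set v : 'rV[R]_3 | forall i, v 0 i \in `[- c, c]].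
  apply/seteqP; split => [v vc|_ [v vc <-] i]; last by rewrite mxE.
  by exists v^T; [move=> i; rewrite mxE | rewrite trmxK].
apply: continuous_compact; last first.
  by apply: (@rV_compact _ _ (fun=> `[- c, c]%classic)) => _; exact: segment_compact.
apply: continuous_subspaceT => M s /= /(nbhs_ballP M^T) [e e0 es].
apply/nbhs_ballP; exists e => //= N [_ MN]; apply: es; split => // i j.
by rewrite !mxE; exact: MN.
Qed.

(** Positions lie on the unit sphere, so a bound on the momentum is all that
    compactness requires. *)
Lemma compact_phase_ball (b : R) : compact (phase `&` [set x | dot x.2 x.2 <= b]).
Proof.
pose K := [set v : 'cV[R]_3 | forall i, v i 0 \in `[- (1 + `|b|), 1 + `|b|]].
have small v : dot v v <= 1 + `|b| -> K v.
  move=> vb i; rewrite in_itv /= -ler_norml.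
  have : v i 0 ^+ 2 <= dot v v.
    by rewrite (dot3 _ _ i) -!expr2 -addrA lerDl addr_ge0 ?sqr_ge0.
  move=> /le_trans/(_ vb); rewrite -(real_normK (num_real _)).
  move: (normr_ge0 (v i 0)) (normr_ge0 b).
  by move: (`|v i 0|) (`|b|) => x c; nra.
apply: (@subclosed_compact _ _ (K `*` K)).
- have cl (f : X -> R) (c : set R) : continuous f -> closed c -> closed (f @^-1` c).
    by move=> fc cc; apply: preimage_closed => // x _; exact: fc.
  have c11 := continuous_dot continuous_fst continuous_fst.
  have c12 := continuous_dot continuous_fst continuous_snd.
  have c22 := continuous_dot continuous_snd continuous_snd.
  rewrite (_ : _ `&` _ = ((fun x => dot x.1 x.1) @^-1` [set 1]) `&`
     ((fun x => dot x.1 x.2) @^-1` [set 0]) `&`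
     ((fun x => dot x.2 x.2) @^-1` [set x | x <= b])).
    do ?apply: closedI; apply: cl => //.
  by [].
- by apply: compact_setX; exact: compact_box.
- move=> [q p] [[/= q1 qp] pb]; split => /=; apply: small.
    by rewrite q1 lerDl.
  by apply: le_trans pb _; rewrite (le_trans (ler_norm _)) // lerDr.
Qed.

(** Only continuity at the points of B is assumed, since the energy is singular
    where q = 0. *)
Lemma closed_preimage_on (B : set X) (F : X -> R) (c : set R) :
  closed B -> (forall x, B x -> {for x, continuous F}) -> closed c ->
  closed (B `&` F @^-1` c).
Proof.
move=> Bcl Fc ccl x xcl.
have Bx : B x by apply: Bcl => V /xcl [y [[By _] Vy]]; exists y.
split => //; apply: ccl => V VF.
have [y [[_ cy] Vy]] := xcl _ (Fc x Bx _ VF).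
by exists (F y).
Qed.

Lemma compact_positive_lower_bound (K : set X) (F : X -> R) :
  compact K -> (forall x, K x -> {for x, continuous F}) -> (forall x, K x -> 0 < F x) ->
  exists2 e, 0 < e & forall x, K x -> e <= F x.
Proof.
move=> Kc Fc F0; have [->|/set0P K0] := eqVneq K set0; first by exists 1.
have Fw : {within K, continuous F}.
  by apply/continuous_in_subspaceT => x /set_mem Kx; exact: Fc.
have [c /set_mem Kc' Fmin] := compact_EVT_min K0 Kc Fw.
by exists (F c); [exact: F0 | move=> x Kx; apply: Fmin; exact: mem_set].
Qed.

(** The set S consists of the zeros of a conserved function F >= 0 at which g is
    positive.  The function g separates S from the other zeros of F, which may
    form further components: two opposite rotations in one plane have the same
    energy and momentum. *)
Section criterion.
Variables (J : 'rV[R]_3) (F g : X -> R) (S : set X) (b : R).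
Hypothesis F_cont : forall x, phase x -> {for x, continuous F}.
Hypothesis g_cont : continuous g.
Hypothesis F_ge0 : forall x, 0 <= F x.
Hypothesis F_proper : forall x, phase x -> F x < 1 -> dot x.2 x.2 <= b.
Hypothesis F_conserved : forall (I : set R) (q p : R -> 'cV[R]_3),
  open I -> is_interval I -> veselova_solution J I q p ->
  forall s t, I s -> I t -> F (q s, p s) = F (q t, p t).
Hypothesis g_neq0 : forall x, phase x -> F x = 0 -> g x != 0.
Hypothesis SE : S = [set x | [/\ phase x, F x = 0 & 0 < g x]].

Definition tube e := [set x | [/\ phase x, F x < e & 0 < g x]].

Let B := phase `&` [set x | dot x.2 x.2 <= b].

Let Bclosed : closed B.
Proof. by apply: compact_closed; [exact: norm_hausdorff|exact: compact_phase_ball]. Qed.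

Let F0B x : phase x -> F x = 0 -> B x.
Proof. by move=> Px Fx; split => //; apply: F_proper => //; rewrite Fx. Qed.

Lemma level_compact : compact S.
Proof.
apply: (@subclosed_compact _ _ B); last by rewrite SE => x [Px Fx _]; exact: F0B.
  rewrite (_ : S = (B `&` F @^-1` [set 0]) `&` (setT `&` g @^-1` [set x | 0 <= x])).
    apply: closedI; apply: closed_preimage_on => //.
      by move=> x [Px _]; exact: F_cont.
    by move=> x _; exact: g_cont.
  rewrite SE; apply/seteqP; split => [x [Px Fx gx]|x [[[Px _] Fx] [_ gx]]].
    by split; split => //=; [exact: F0B | exact: ltW].
  by split => //; rewrite lt_neqAle eq_sym g_neq0.
exact: compact_phase_ball.
Qed.

(** On a compact set the function F has a positive lower bound away from S, and
    another one on the hypersurface g = 0.  A solution with F below both bounds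
    can neither leave a given neighbourhood of S nor reach g = 0, since F is
    constant along it. *)
Lemma tube_criterion U : phase_nbhs S U ->
  exists e, [/\ 0 < e, phase_nbhs S (tube e) & confines J (tube e) U].
Proof.
move=> [W /set_nbhsP [C [Copen SC CW]] UE].
have BF x : B x -> {for x, continuous F} by move=> [Px _]; exact: F_cont.
(* The part of phase space where g >= 0, outside the given neighbourhood. *)
have [e1 e10 He1] : exists2 e, 0 < e & forall x, B x -> ~ C x -> 0 <= g x -> e <= F x.
  pose K := (B `&` ~` C) `&` g @^-1` [set x | 0 <= x].
  have [||x [[Bx nCx] gx]|e e0 He] := @compact_positive_lower_bound K F.
  - apply: (@subclosed_compact _ _ B); [|exact: compact_phase_ball|by move=> x [[]]].
    apply: closedI; first by apply: closedI => //; exact: open_closedC.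
    rewrite -[X in closed X]setTI; apply: closed_preimage_on; [exact: closedT| |exact: closed_ge].
    by move=> x _; exact: g_cont.
  - by move=> x [[Bx _] _]; exact: BF.
  - rewrite lt_neqAle F_ge0 andbT eq_sym; apply/eqP => Fx; apply: nCx; apply: SC.
    have [Px _] := Bx; rewrite SE; split => //.
    by rewrite lt_neqAle eq_sym g_neq0.
  - by exists e => // x Bx nCx gx; apply: He.
(* The hypersurface that solutions must not cross. *)
have [e2 e20 He2] : exists2 e, 0 < e & forall x, B x -> g x = 0 -> e <= F x.
  pose K := B `&` g @^-1` [set 0].
  have [||x [Bx gx]|e e0 He] := @compact_positive_lower_bound K F.
  - apply: (@subclosed_compact _ _ B); [|exact: compact_phase_ball|by move=> x []].
    apply: closed_preimage_on => //.
    by move=> x _; exact: g_cont.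
  - by move=> x [Bx _]; exact: BF.
  - rewrite lt_neqAle F_ge0 andbT eq_sym; apply/eqP => Fx.
    by have [/g_neq0/(_ Fx)/eqP] := Bx.
  - by exists e => // x Bx gx; apply: He.
pose e := Num.min 1 (Num.min e1 e2).
have e0 : 0 < e by rewrite !lt_min ltr01 e10.
exists e; split => //.
  (* The tube is open only relatively to phase space, so the complement of phase
     space is added to obtain a neighbourhood in the ambient space. *)
  exists (tube e `|` ~` phase); last first.
    apply/seteqP; split => [x tx|x [[//|nP] Px]]; last by case: (nP Px).
    by split; [left|case: tx].
  move=> x; rewrite SE => -[Px Fx gx].
  have nF : \forall y \near x, F y < e.
    by apply: (cvgr_lt (F x) (F_cont Px)); rewrite Fx.
  have ng : \forall y \near x, 0 < g y.
    have gx' : g @ x --> g x by exact: g_cont.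
    by apply: (cvgr_gt _ gx').
  near=> y; have [Py|] := pselect (phase y); last by right.
  by left; split => //; near: y.
move=> I q p Iopen Iitv sol t0 It0 [P0 F0 g0] t It.
have Ft s : I s -> F (q s, p s) < e by move=> Is; rewrite (F_conserved _ _ sol Is It0).
have Bt s : I s -> B (q s, p s).
  move=> Is; have [Ps _ _] := sol _ Is; split => //; apply: F_proper => //.
  by apply: lt_le_trans (Ft _ Is) _; rewrite ge_min lexx.
(* Otherwise g would vanish somewhere between t0 and t. *)
have gt : 0 < g (q t, p t).
  rewrite ltNge; apply/negP => gt.
  pose h s := g (q s, p s).
  have hc s : I s -> {for s, continuous h}.
    move=> Is; have [_ [qd _] [pd _]] := sol _ Is.
    have qc := derivable_continuous qd.
    have pc := derivable_continuous pd.
    apply: (@continuous_comp _ _ _ (fun s => (q s, p s)) g); last exact: g_cont.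
    exact: (cvg_pair qc pc).
  have bad s : I s -> h s != 0.
    move=> Is; apply/eqP => hs; have := He2 _ (Bt _ Is) hs.
    by rewrite leNgt (lt_le_trans (Ft _ Is)) // !ge_min lexx !orbT.
  have key a c : I a -> I c -> a <= c ->
      ~ (Num.min (h a) (h c) <= 0 <= Num.max (h a) (h c)).
    move=> Ia Ic ac h0; have sub x : x \in `[a, c] -> I x.
      by rewrite in_itv /= => hx; exact: Iitv hx.
    have [|x /sub Ix /eqP] := IVT ac _ h0; last by apply/negP; exact: bad.
    by apply/continuous_in_subspaceT => x /set_mem /sub Ix; exact: hc.
  have [tt|tt] := leP t t0.
    apply: (key _ _ It It0 tt).
    by rewrite ge_min le_max /h gt (ltW g0) orbT.
  apply: (key _ _ It0 It (ltW tt)).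
  by rewrite ge_min le_max /h gt (ltW g0) orbT.
rewrite UE; split; last by have [] := sol _ It.
apply: CW; have [//|nC] := pselect (C (q t, p t)).
have := He1 _ (Bt _ It) nC (ltW gt).
by rewrite leNgt (lt_le_trans (Ft _ It)) // !ge_min lexx !orbT.
Unshelve. all: by end_near. Qed.

End criterion.
End topology.

(** * Steady rotations are uniform circular motions *)

Lemma circle_surj (R : realType) (w a b : R) : w != 0 -> a ^+ 2 + b ^+ 2 = 1 ->
  exists t, cos (w * t) = a /\ sin (w * t) = b.
Proof.
move=> w0 ab.
suff [t [ct st]] : exists t, cos t = a /\ sin t = b.
  by exists (w^-1 * t); rewrite mulVKf.
have a1 : -1 <= a <= 1.
  rewrite -ler_norml -(@ler_pXn2r _ 2) ?nnegrE // expr1n.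
  by rewrite real_normK ?num_real // -ab lerDl sqr_ge0.
have ca : cos (acos a) = a by apply: acosK; rewrite in_itv.
have sa : sin (acos a) = `|b|.
  by rewrite sin_acos // -ab addrC addrA addNr add0r sqrtr_sqr.
have [b0|b0] := leP 0 b.
  by exists (acos a); rewrite ca sa ger0_norm.
by exists (- acos a); rewrite cosN sinN ca sa ltr0_norm // opprK.
Qed.

Section steady_motion.
Variables (R : realType) (J : 'rV[R]_3).
Hypothesis J_gt0 : forall i, 0 < J 0 i.
Local Notation phase := (cotangent_sphere R).
Variables (q p : R -> 'cV[R]_3) (n : 'cV[R]_3).
Hypothesis steady : steady_rotation J q p.
Hypothesis about : rotates_about n q p.
Hypothesis n0 : n != 0.

Let sol : veselova_solution J setT q p := proj1 steady.

Let ph t : phase (q t, p t).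
Proof. by have [] := sol (t := t) I. Qed.

Let P2 := dot (p 0) (p 0).

Lemma steady_momentum t : dot (p t) (p t) = dot (p 0) (p 0).
Proof.
apply: (@derive0_cst R setT (fun s => dot (p s) (p s))) => // s _.
exact: (is_derive_momentum J_gt0 sol).
Qed.

Let e := double_energy J (q 0, p 0).

Let energy_cst t : double_energy J (q t, p t) = e.
Proof.
apply: (@derive0_cst R setT (fun s => double_energy J (q s, p s))) => // s _.
exact: (is_derive_energy J_gt0 sol).
Qed.

Lemma steady_momentum_neq0 : dot (p 0) (p 0) != 0.
Proof.
apply/eqP => /dot_eq0 p0; have [_ [W W0 /(_ 0) OW]] := steady.
move/eqP: W0; apply; rewrite -OW /Omega.
suff -> : derive1 q 0 = 0 by rewrite linear0 mulmx0 mul0mx subrr.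
have [_ [_ qd] _] := sol (t := 0) I.
rewrite derive1E qd p0 veselova_qdotE ?p0 -?p0 //.
apply/colP => i; rewrite !mxE p0 !mxE; ring.
Qed.

Let P20 : P2 != 0 := steady_momentum_neq0.

Let e_gt0 : 0 < e.
Proof.
rewrite divr_gt0 // ?inertia_form_gt0 ?steady_momentum_neq0 //.
by rewrite adjugate_form_gt0 // (proj1 (ph 0)) oner_eq0.
Qed.

Lemma steady_normal t : n = (dot n (cross (q t) (p t)) / P2) *: cross (q t) (p t).
Proof.
have [nq np] := about t.
rewrite [LHS](frame_expansion _ (ph t)) steady_momentum // nq np.
by rewrite mul0r !scale0r !add0r.
Qed.

(* The velocity is orthogonal to q and to n, like p, so it is a multiple of p;
   the factor is constant because the energy and the momentum are conserved. *)
Let qdotE t : veselova_qdot J (q t) (p t) = (e / P2) *: p t.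
Proof.
set z := veselova_qdot J (q t) (p t).
have [_ qd _] := sol (t := t) I.
have zq : dot z (q t) = 0.
  by rewrite /z veselova_qdotE // dotZl cross_dotr mulr0.
have zp : dot z (p t) = e by rewrite dotC dot_qdot.
have zn : dot n z = 0.
  have [_ h] := is_derive_dot (is_derive_cst n t 1) qd.
  rewrite (_ : (fun s => _) = cst 0) in h; last by apply/funext => s; case: (about s).
  by move: h; rewrite derive_cst /dot trmx0 mul0mx mxE add0r => <-.
rewrite [LHS](frame_expansion _ (ph t)) steady_momentum // zq zp scale0r add0r.
rewrite (_ : dot z (cross _ _) = 0) ?mul0r ?scale0r ?addr0 //.
move: zn; rewrite (steady_normal t) dotZl => /eqP; rewrite mulf_eq0 => /orP[|/eqP].
  by move=> /eqP h; move: n0; rewrite (steady_normal t) h scale0r eqxx.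
by rewrite dotC.
Qed.

(** The equations of motion become q' = (e / P^2) p and p' = - e q with constants
    e = 2 H and P = |p|, a harmonic oscillator of frequency w = e / P. *)
Lemma steady_circular : exists P w : R,
  [/\ 0 < P, w != 0, P ^+ 2 = dot (p 0) (p 0) &
   forall t, q t = cos (w * t) *: q 0 + (sin (w * t) / P) *: p 0 /\
             p t = cos (w * t) *: p 0 - (P * sin (w * t)) *: q 0].
Proof.
have P2_gt0 : 0 < P2 := dot_gt0 P20.
pose P := Num.sqrt P2; have P_gt0 : 0 < P by rewrite sqrtr_gt0.
have PP : P ^+ 2 = P2 by rewrite sqr_sqrtr // ltW.
have P0 : P != 0 by rewrite gt_eqF.
pose w := e / P; have w0 : w != 0 by rewrite mulf_neq0 ?invr_eq0 ?gt_eqF.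
exists P, w; split => //.
have wd (t : R) : is_derive t 1 (fun s : R => w * s) w.
  by apply: (is_derive_eq (is_deriveZ w (is_derive_id t 1))); rewrite /GRing.scale /= mulr1.
have cd (t : R) : is_derive t 1 (fun s => cos (w * s)) (- w * sin (w * t)).
  apply: (is_derive_eq (is_derive1_comp (is_derive_cos _) (wd t))).
  by rewrite /GRing.scale /=; ring.
have sd (t : R) : is_derive t 1 (fun s => sin (w * s)) (w * cos (w * t)).
  apply: (is_derive_eq (is_derive1_comp (is_derive_sin _) (wd t))).
  by rewrite /GRing.scale /=; ring.
have qd (t : R) i : is_derive t 1 (fun s => q s i 0) (w / P * p t i 0).
  have [_ qd _] := sol (t := t) I; apply: (is_derive_eq (is_derive_coord i qd)).
  by rewrite qdotE mxE /w -PP; field.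
have pd (t : R) i : is_derive t 1 (fun s => p s i 0) (- (w * P) * q t i 0).
  apply: (is_derive_eq (is_derive_coord i (is_derive_p J_gt0 sol (t := t) I))).
  by rewrite energy_cst mxE /w divfK.
have cst0 (f : R -> R) : (forall t : R, is_derive t 1 f 0) -> forall t, f t = f 0.
  by move=> f0 t; apply: (@derive0_cst R setT f).
(* Rotating the solution back by the angle w t yields two constants of motion,
   whose values at time 0 are q and p. *)
have aE i : forall t, cos (w * t) * q t i 0 - sin (w * t) / P * p t i 0 = q 0 i 0.
  move=> t; pose f s : R := cos (w * s) * q s i 0 - sin (w * s) / P * p s i 0.
  have fd (s : R) : is_derive s 1 f 0; last first.
    by rewrite -[LHS]/(f t) (cst0 f fd) /f mulr0 cos0 sin0; ring.
  pose f1 := (fun s => cos (w * s)) * (fun s => q s i 0).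
  pose f2 := P^-1 *: ((fun s => sin (w * s)) * (fun s => p s i 0)).
  rewrite (_ : f = f1 - f2); last first.
    by apply/funext => x; rewrite /f /f1 /f2 /GRing.scale /= !fctE /= /GRing.scale /=; ring.
  apply: (is_derive_eq (is_deriveB (is_deriveM (cd s) (qd s i))
            (is_deriveZ P^-1 (is_deriveM (sd s) (pd s i))))).
  by rewrite /GRing.scale /=; field.
have bE i : forall t, P * sin (w * t) * q t i 0 + cos (w * t) * p t i 0 = p 0 i 0.
  move=> t; pose f s : R := P * sin (w * s) * q s i 0 + cos (w * s) * p s i 0.
  have fd (s : R) : is_derive s 1 f 0; last first.
    by rewrite -[LHS]/(f t) (cst0 f fd) /f mulr0 cos0 sin0; ring.
  pose f1 := P *: ((fun s => sin (w * s)) * (fun s => q s i 0)).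
  pose f2 := (fun s => cos (w * s)) * (fun s => p s i 0).
  rewrite (_ : f = f1 + f2); last first.
    by apply/funext => x; rewrite /f /f1 /f2 /GRing.scale /= !fctE /= /GRing.scale /=; ring.
  apply: (is_derive_eq (is_deriveD (is_deriveZ P (is_deriveM (sd s) (qd s i)))
            (is_deriveM (cd s) (pd s i)))).
  by rewrite /GRing.scale /=; field.
move=> t; have cs := cos2Dsin2 (w * t).
split; apply/colP => i; rewrite !mxE -(aE i t) -(bE i t);
  move: cs; move: (cos _) (sin _) => c s cs.
- transitivity ((c ^+ 2 + s ^+ 2) * q t i 0); first by rewrite cs mul1r.
  by field.
- transitivity ((c ^+ 2 + s ^+ 2) * p t i 0); first by rewrite cs mul1r.
  by field.
Qed.

(** The circle is determined by the vector q x p alone: every unit vector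
    orthogonal to it is reached by q, and then p follows from
    [cross_crossK]. *)
Lemma steady_trajectory :
  trajectory q p = [set x | phase x /\ cross x.1 x.2 = cross (q 0) (p 0)].
Proof.
have [P [w [P_gt0 w0 PP qpE]]] := steady_circular.
have P0 : P != 0 by rewrite gt_eqF.
have crossE t : cross (q t) (p t) = cross (q 0) (p 0).
  have [-> ->] := qpE t; apply/colP => i; rewrite !mxE.
  have cs := cos2Dsin2 (w * t); move: cs; move: (cos _) (sin _) => c s cs.
  rewrite -[RHS]mul1r -cs; by field.
apply/seteqP; split => [_ [t _ <-] /=|[x y] /= [xy xyE]]; first by split.
have x1 : dot x x = 1 by case: xy.
have xE : x = dot x (q 0) *: q 0 + (dot x (p 0) / P2) *: p 0.
  rewrite [LHS](frame_expansion _ (ph 0)) ?steady_momentum_neq0 // -xyE.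
  by rewrite (dotC x (cross _ _)) cross_dotl mul0r scale0r addr0.
have [||t [ct st]] := @circle_surj R w (dot x (q 0)) (dot x (p 0) / P) => //.
  transitivity (dot x (q 0) * dot x (q 0) + dot x (p 0) / P2 * dot x (p 0)).
    by rewrite /P2 -PP; field.
  by rewrite -!dotZr -dotDr -xE.
have qt : q t = x.
  have [-> _] := qpE t; rewrite ct st [RHS]xE /P2 -PP; congr (_ + _ *: _); by field.
exists t => //=; congr (_, _) => //.
by rewrite -(cross_crossK (ph t)) -(cross_crossK xy) crossE qt xyE.
Qed.
End steady_motion.

(** * Critical levels of the energy *)

Section critical_level.
Variables (R : realType) (J : 'rV[R]_3).
Hypothesis J_gt0 : forall i, 0 < J 0 i.
Implicit Types (q p u v : 'cV[R]_3) (i j k : 'I_3).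
Local Notation phase := (cotangent_sphere R).

(** For fixed |p|, the sign of the left-hand side compares 2 H with |p|^2 / I_i, its
    value on rotations about the i-th axis.  When I_i is extremal, the right-hand
    side has coefficients of one sign for a suitable order of j and k, so its
    zeros can be read off. *)
Lemma critical_identity (i j k : 'I_3) q p : i != j -> i != k -> j != k ->
  phase (q, p) ->
  moment J i * inertia_form J p - dot p p * adjugate_form J q =
    (moment J i - moment J k) *
      (moment J i * p i 0 ^+ 2 + moment J j * dot p p * q i 0 ^+ 2)
    + moment J i * (moment J k - moment J j) * cross q p j 0 ^+ 2.
Proof.
move=> ij ik jk qp; rewrite cross_sqr //; have [/= q1 _] := qp.
have [e1 e2 e3 e4] := ord3_cyc i.
have pk : p k 0 ^+ 2 = dot p p - p i 0 ^+ 2 - p j 0 ^+ 2.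
  by rewrite (dot3 p p i); have [[-> ->]|[-> ->]] := ord3_others ij ik jk; ring.
have qk : q k 0 ^+ 2 = 1 - q i 0 ^+ 2 - q j 0 ^+ 2.
  by rewrite -q1 (dot3 q q i); have [[-> ->]|[-> ->]] := ord3_others ij ik jk; ring.
rewrite /inertia_form /adjugate_form !(sum3 _ i) !e1 !e2 !e3 !e4.
by move: pk qk; have [[-> ->]|[-> ->]] := ord3_others ij ik jk => -> ->; ring.
Qed.

Lemma critical_levelP i q p : phase (q, p) ->
  double_energy J (q, p) = dot p p / moment J i <->
  moment J i * inertia_form J p - dot p p * adjugate_form J q = 0.
Proof.
move=> [/= q1 _].
have D0 : adjugate_form J q != 0 by rewrite gt_eqF // adjugate_form_gt0 // q1 oner_eq0.
have M0 : moment J i != 0 by rewrite gt_eqF // moment_gt0.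
rewrite /double_energy /=; split => [/eqP|/eqP].
  by rewrite eqr_div // => /eqP h; rewrite mulrC h mulrC subrr.
rewrite subr_eq0 => /eqP h; apply/eqP; rewrite eqr_div //; apply/eqP.
by rewrite mulrC h.
Qed.

(** When I_i is strictly extremal, so that the motion in the plane orthogonal to the
    i-th axis is a nondegenerate extremum of the energy, the indices j and k can
    be ordered to give all coefficients of [critical_identity] the same sign. *)
Lemma strict_extremum_level i j k (u v : 'cV[R]_3) :
  i != j -> i != k -> j != k ->
  (moment J j <= moment J k /\ moment J k < moment J i) \/
  (moment J i < moment J k /\ moment J k <= moment J j) ->
  phase (u, v) -> dot v v != 0 ->
  (double_energy J (u, v) = dot v v / moment J i <-> u i 0 = 0 /\ v i 0 = 0).
Proof.
move=> ij ik jk ext uv v0; rewrite critical_levelP // (critical_identity ij ik jk uv).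
split => [|[ui vi]]; last first.
  have -> : cross u v j 0 = 0 by apply: coord_plane_cross ui vi _ _; rewrite eq_sym.
  by rewrite ui vi expr0n /= !mulr0 !addr0 mulr0.
have v_gt0 := dot_gt0 v0.
have a0 := moment_gt0 J_gt0 i; have b0 := moment_gt0 J_gt0 j.
set A := moment J i * v i 0 ^+ 2 + _; set B := cross _ _ _ _ ^+ 2.
have B0 : 0 <= B by exact: sqr_ge0.
have A1 : 0 <= moment J i * v i 0 ^+ 2 by rewrite mulr_ge0 ?sqr_ge0 // ltW.
have bp : 0 < moment J j * dot v v by rewrite mulr_gt0.
have A2 : 0 <= moment J j * dot v v * u i 0 ^+ 2 by rewrite mulr_ge0 ?sqr_ge0 // ltW.
move=> T0; suff /eqP : A = 0.
  rewrite paddr_eq0 // !mulf_eq0 !(gt_eqF a0) (gt_eqF b0) (gt_eqF v_gt0) /= !orbb.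
  by move=> /andP[/eqP ? /eqP].
have A0 : 0 <= A by rewrite addr_ge0.
apply/eqP; rewrite eq_le A0 andbT; apply/negPn/negP; rewrite -ltNge => Apos.
case: ext => -[h1 h2].
- have : 0 < (moment J i - moment J k) * A by rewrite mulr_gt0 // subr_gt0.
  have : 0 <= moment J i * (moment J k - moment J j) * B.
    by apply: mulr_ge0 => //; apply: mulr_ge0; rewrite ?subr_ge0 // ltW.
  move: T0; set x := _ * A; set y := _ * B; lra.
- have : 0 < (moment J k - moment J i) * A by rewrite mulr_gt0 // subr_gt0.
  have : 0 <= moment J i * (moment J j - moment J k) * B.
    by apply: mulr_ge0 => //; apply: mulr_ge0; rewrite ?subr_ge0 // ltW.
  move: T0; rewrite -(opprB (moment J i) (moment J k)) -(opprB (moment J k) (moment J j)).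
  rewrite mulrN !mulNr; set x := _ * A; set y := _ * B; lra.
Qed.

End critical_level.

(** * Stability of energy-momentum levels *)

Section energy_momentum.
Variables (R : realType) (J : 'rV[R]_3).
Hypothesis J_gt0 : forall i, 0 < J 0 i.
Local Notation X := ('cV[R]_3 * 'cV[R]_3)%type.
Local Notation phase := (cotangent_sphere R).

Definition energy_momentum_gap (P2 c : R) (x : X) : R :=
  (dot x.2 x.2 - P2) ^+ 2 + (double_energy J x - c) ^+ 2.

Lemma continuous_energy x : phase x -> {for x, continuous (double_energy J)}.
Proof.
move=> [x1 _].
have wc (w : 'I_3 -> R) (f : X -> 'cV[R]_3) : continuous f ->
    continuous (fun x => \sum_i w i * f x i 0 ^+ 2).
  move=> fc; apply: continuous_sum3 => i y.
  apply: cvgM; first exact: cvg_cst.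
  by rewrite expr2; apply: cvgM; exact: continuous_coord.
apply: cvgM; first exact: (wc _ _ (@continuous_snd R)).
apply: cvgV; last exact: (wc _ _ (@continuous_fst R)).
by rewrite gt_eqF // adjugate_form_gt0 // x1 oner_eq0.
Qed.

(** Conservation of energy and momentum makes the sum of the squared deviations
    from their values on S an admissible function for [tube_criterion]. *)
Lemma energy_momentum_stability (P2 c : R) (g : X -> R) (S : set X) :
  continuous g ->
  (forall x, phase x -> dot x.2 x.2 = P2 -> double_energy J x = c -> g x != 0) ->
  S = [set x | [/\ phase x, dot x.2 x.2 = P2, double_energy J x = c & 0 < g x]] ->
  compact S /\ forall U, phase_nbhs S U -> exists e,
    [/\ 0 < e, phase_nbhs S (tube (energy_momentum_gap P2 c) g e) &
        confines J (tube (energy_momentum_gap P2 c) g e) U].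
Proof.
move=> gc g0 SE; pose F := energy_momentum_gap P2 c.
have F0 x : F x = 0 <-> dot x.2 x.2 = P2 /\ double_energy J x = c.
  rewrite /F /energy_momentum_gap; split => [/eqP|[-> ->]]; last first.
    by rewrite !subrr expr0n addr0.
  by rewrite paddr_eq0 ?sqr_ge0 // !sqrf_eq0 !subr_eq0 => /andP[/eqP ? /eqP].
have Fcont x : phase x -> {for x, continuous F}.
  move=> px; apply: cvgD.
    have h : {for x, continuous (fun x : X => dot x.2 x.2 - P2)}.
      apply: cvgB; last exact: cvg_cst.
      exact: (continuous_dot (@continuous_snd R) (@continuous_snd R)).
    exact: (cvgM h h).
  have h : {for x, continuous (fun x : X => double_energy J x - c)}.
    by apply: cvgB; [exact: continuous_energy|exact: cvg_cst].
  exact: (cvgM h h).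
have Fge0 x : 0 <= F x by rewrite addr_ge0 ?sqr_ge0.
have Fproper x : phase x -> F x < 1 -> dot x.2 x.2 <= P2 + 1.
  move=> _; rewrite /F /energy_momentum_gap.
  move: (dot _ _) (double_energy _ _) => a b h; have := sqr_ge0 (b - c); nra.
have Fcons (I : set R) (q p : R -> 'cV[R]_3) : open I -> is_interval I ->
    veselova_solution J I q p -> forall s t, I s -> I t -> F (q s, p s) = F (q t, p t).
  move=> _ Iitv sol s t Is It; rewrite /F /energy_momentum_gap /=.
  have -> := derive0_cst Iitv (is_derive_momentum J_gt0 sol) Is It.
  by have -> := derive0_cst Iitv (is_derive_energy J_gt0 sol) Is It.
have g0' x : phase x -> F x = 0 -> g x != 0.
  by move=> px /F0 [? ?]; exact: g0.
have SE' : S = [set x | [/\ phase x, F x = 0 & 0 < g x]].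
  rewrite SE; apply/seteqP; split => x.
    by move=> [? ? ? ?]; split => //; apply/F0.
  by move=> [? /F0[? ?] ?]; split.
split; first exact: (level_compact Fcont gc Fproper g0' SE').
by move=> U; exact: (tube_criterion Fcont gc Fge0 Fproper Fcons g0' SE').
Qed.

End energy_momentum.

(** * Tops whose eigenvalues are all distinct or all equal *)

Section single_trajectory.
Variables (R : realType) (J : 'rV[R]_3).
Hypothesis J_gt0 : forall i, 0 < J 0 i.
Local Notation X := ('cV[R]_3 * 'cV[R]_3)%type.
Local Notation phase := (cotangent_sphere R).
Variables (q p : R -> 'cV[R]_3) (n : 'cV[R]_3).
Hypothesis steady : steady_rotation J q p.
Hypothesis about : rotates_about n q p.
Hypothesis n0 : n != 0.
Implicit Types (i j k : 'I_3).

Let P2 := dot (p 0) (p 0).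
Let P20 : P2 != 0 := steady_momentum_neq0 J_gt0 steady.
Let P2_gt0 : 0 < P2 := dot_gt0 P20.

Let ph t : phase (q t, p t).
Proof. by have [] := (proj1 steady) t I. Qed.

Let trajE : trajectory q p = [set x | phase x /\ cross x.1 x.2 = cross (q 0) (p 0)].
Proof. exact: (steady_trajectory J_gt0 steady about n0). Qed.

Lemma rotates_about_coord i : (forall j, j != i -> n j 0 = 0) ->
  forall t, q t i 0 = 0 /\ p t i 0 = 0.
Proof.
move=> nj t; have ni := axis_coord_neq0 n0 nj; have [] := about t.
rewrite !(dot_axis _ nj) => /eqP + /eqP.
by rewrite !mulf_eq0 !(negbTE ni) /= => /eqP -> /eqP ->.
Qed.

(** The extremal level consists of two circles, one for each orientation of q x p,
    and the sign of the i-th coordinate of this vector tells them apart. *)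
Lemma strict_extremum_stable i j k :
  i != j -> i != k -> j != k -> (forall l, l != i -> n l 0 = 0) ->
  (moment J j <= moment J k /\ moment J k < moment J i) \/
  (moment J i < moment J k /\ moment J k <= moment J j) ->
  Lyapunov_stable J (trajectory q p).
Proof.
move=> ij ik jk ni ext; pose m0 := cross (q 0) (p 0).
have tE : trajectory q p = [set x | phase x /\ cross x.1 x.2 = m0] := trajE.
have [qi pi] := rotates_about_coord ni 0.
have levelP x : phase x -> dot x.2 x.2 = P2 ->
    double_energy J x = P2 / moment J i <-> x.1 i 0 = 0 /\ x.2 i 0 = 0.
  case: x => u v uv /= vP; rewrite -vP.
  by apply: (strict_extremum_level J_gt0 ij ik jk ext uv); rewrite vP.
have m0j l : l != i -> m0 l 0 = 0 by exact: coord_plane_cross.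
have m0P : m0 i 0 ^+ 2 = P2.
  by rewrite cross_sqr // qi pi expr0n /= mulr0 !subr0.
pose g (x : X) := dot m0 (cross x.1 x.2).
have gE x : g x = m0 i 0 * cross x.1 x.2 i 0 by exact: dot_axis.
have gcont : continuous g.
  rewrite (_ : g = fun x => m0 i 0 * cross x.1 x.2 i 0); last exact/funext.
  by move=> x; apply: cvgM; [exact: cvg_cst|exact: continuous_cross].
have mi x : phase x -> dot x.2 x.2 = P2 -> x.1 i 0 = 0 -> x.2 i 0 = 0 ->
    cross x.1 x.2 i 0 ^+ 2 = P2.
  by case: x => u v uv /= vP ui vi; rewrite cross_sqr // ui vi vP expr0n /= mulr0 !subr0.
have g0 x : phase x -> dot x.2 x.2 = P2 -> double_energy J x = P2 / moment J i -> g x != 0.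
  move=> px xP /(levelP _ px xP)[xi yi]; rewrite gE -sqrf_eq0 exprMn m0P (mi _ px xP xi yi).
  by rewrite mulf_neq0.
have SE : trajectory q p = [set x | [/\ phase x, dot x.2 x.2 = P2,
    double_energy J x = P2 / moment J i & 0 < g x]].
  rewrite tE; apply/seteqP; split => [x [px xm]|x [px xP /(levelP _ px xP)[xi yi]]].
    have xP : dot x.2 x.2 = P2.
      by case: x px xm => u v uv /= xm; rewrite -(dot_cross uv) xm dot_cross.
    split => //; last by rewrite /g xm (dot_axis _ m0j) -expr2 m0P.
    apply/levelP => //; case: x px xm {xP} => u v uv /= xm.
    have m0n0 : m0 i 0 != 0 by rewrite -sqrf_eq0 m0P.
    have := cross_dotl u v; have := cross_dotr u v; rewrite xm !(dot_axis _ m0j).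
    by move=> /eqP + /eqP; rewrite !mulf_eq0 !(negbTE m0n0) /= => /eqP -> /eqP ->.
  rewrite gE => gpos; split => //; apply/colP => l.
  have [->|li] := eqVneq l i; last by rewrite m0j // (coord_plane_cross xi yi).
  have /eqP : cross x.1 x.2 i 0 ^+ 2 = m0 i 0 ^+ 2 by rewrite m0P mi.
  rewrite eqf_sqr => /orP[/eqP //|/eqP h]; move: gpos; rewrite h mulrN oppr_gt0.
  by rewrite -expr2 ltNge sqr_ge0.
have [Sc St] := energy_momentum_stability J_gt0 gcont g0 SE.
split => //; first by rewrite tE => x [].
by move=> U /St [e [_ ? ?]]; exists (tube (energy_momentum_gap J P2 (P2 / moment J i)) g e).
Qed.

(** When the three eigenvalues agree, q moves along great circles and the whole
    vector q x p is conserved; it characterizes the trajectory. *)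
Lemma spherical_stable : (forall i j, J 0 i = J 0 j) -> Lyapunov_stable J (trajectory q p).
Proof.
move=> Jc; pose m0 := cross (q 0) (p 0).
have tE : trajectory q p = [set x | phase x /\ cross x.1 x.2 = m0] := trajE.
pose F (x : X) := \sum_i (cross x.1 x.2 i 0 - m0 i 0) ^+ 2.
have Fcont x : phase x -> {for x, continuous F}.
  move=> _; apply: continuous_sum3 => i y.
  have h : {for y, continuous (fun x : X => cross x.1 x.2 i 0 - m0 i 0)}.
    by apply: cvgB; [exact: continuous_cross|exact: cvg_cst].
  exact: (cvgM h h).
have Fge0 x : 0 <= F x by apply: sumr_ge0 => i _; exact: sqr_ge0.
have F0 x : F x = 0 -> cross x.1 x.2 = m0.
  move=> h; apply/colP => i; apply/eqP; rewrite -subr_eq0 -sqrf_eq0.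
  by have /(_ i isT)/eqP := @psumr_eq0P _ _ _ _ (fun j _ => sqr_ge0 _) h.
(* From |m|^2 <= 2 |m - m0|^2 + 2 |m0|^2, with |m - m0| < 1. *)
have Fproper x : phase x -> F x < 1 -> dot x.2 x.2 <= 2 + 2 * dot m0 m0.
  case: x => u v uv F1; rewrite -(dot_cross uv).
  have : dot (cross u v) (cross u v) <= 2 * F (u, v) + 2 * dot m0 m0.
    rewrite !dotE /F !mulr_sumr -big_split; apply: ler_sum => i _ /=.
    by move: (cross u v i 0) (m0 i 0) => a b; have := sqr_ge0 (a - 2 * b); nra.
  lra.
have Fcons (I : set R) (x y : R -> 'cV[R]_3) : open I -> is_interval I ->
    veselova_solution J I x y -> forall s t, I s -> I t -> F (x s, y s) = F (x t, y t).
  move=> _ Iitv sol s t Is It; apply: eq_bigr => i _ /=; congr ((_ - _) ^+ 2).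
  apply: (derive0_cst (f := fun s => cross (x s) (y s) i 0) Iitv _ Is It) => r Ir.
  have [xy xd _] := sol r Ir; have yd := is_derive_p J_gt0 sol Ir.
  pose a j s := x s j 0; pose b j s := y s j 0.
  rewrite (_ : (fun s => _) = a (i + 1) * b (i + 2) - a (i + 2) * b (i + 1)); last first.
    by apply/funext => z; rewrite mxE.
  have xj j := is_derive_coord j xd; have yj j := is_derive_coord j yd.
  apply: (is_derive_eq (is_deriveB (is_deriveM (xj (i + 1)) (yj (i + 2)))
     (is_deriveM (xj (i + 2)) (yj (i + 1))))).
  have -> : veselova_qdot J (x r) (y r) =
      (shifted_inertia J (x r) 0 / adjugate_form J (x r)) *: y r.
    rewrite veselova_qdotE // mulrC -scalerA; congr (_ *: _).
    rewrite -[in RHS](cross_crossK xy); apply/colP => j; rewrite !mxE.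
    by rewrite /shifted_inertia !(Jc _ 0); ring.
  by rewrite !mxE /GRing.scale /=; ring.
have g0 (x : X) : phase x -> F x = 0 -> (cst 1 : X -> R) x != 0 by rewrite oner_eq0.
have SE : trajectory q p = [set x | [/\ phase x, F x = 0 & 0 < (cst 1 : X -> R) x]].
  rewrite tE; apply/seteqP; split => x [px].
    by move=> xm; split => //; rewrite /F xm big1 // => i _; rewrite subrr expr0n.
  by move=> /F0.
have gc : continuous (cst 1 : X -> R) by exact: cst_continuous.
split.
- exact: (level_compact Fcont gc Fproper g0 SE).
- by rewrite tE => x [].
- move=> U /(tube_criterion Fcont gc Fge0 Fproper Fcons g0 SE)[e [_ ? ?]].
  by exists (tube F (cst 1) e).
Qed.

End single_trajectory.

(** * Axisymmetric tops *)

Section axial_group.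
Variables (R : realType).
Implicit Types (q p u v w : 'cV[R]_3) (i : 'I_3).
Local Notation phase := (cotangent_sphere R).

Definition frame_mx u v w : 'M[R]_3 :=
  \matrix_(i, j) [:: u i 0; v i 0; w i 0]`_j.

Lemma frame_mx_ortho u v w :
  dot u u = 1 -> dot v v = 1 -> dot w w = 1 ->
  dot u v = 0 -> dot u w = 0 -> dot v w = 0 ->
  (frame_mx u v w)^T *m frame_mx u v w = 1%:M.
Proof.
move=> uu vv ww uv uw vw.
have vu : dot v u = 0 by rewrite dotC.
have wu : dot w u = 0 by rewrite dotC.
have wv : dot w v = 0 by rewrite dotC.
apply/matrixP => a b; rewrite !mxE; under eq_bigr do rewrite !mxE.
by move: uu vv ww uv uw vw vu wu wv; rewrite !dotE;
  have [->|->|->] := ord3P a; have [->|->|->] := ord3P b.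
Qed.

Lemma frame_mxE u v w : [/\ frame_mx u v w *m delta_mx 0 0 = u,
  frame_mx u v w *m delta_mx 1 0 = v & frame_mx u v w *m delta_mx 2 0 = w].
Proof. by split; rewrite -colE; apply/colP => i; rewrite !mxE. Qed.

(** The orthonormal frames q, p, q x p of the two states (normalized) are related by
    a unique orthogonal map.  It fixes the axis when the k-th coordinates of
    corresponding frame vectors agree.  For the third vector they agree only up
    to sign, by [cross_sqr], and the sign is adjusted by a reflection. *)
Lemma O2_connects (k : 'I_3) q p u v :
  phase (q, p) -> phase (u, v) -> dot p p != 0 -> dot v v = dot p p ->
  u k 0 = q k 0 -> v k 0 = p k 0 ->
  exists2 g, O2 R k g & (u, v) = diag_act g (q, p).
Proof.
move=> qp uv p0 vp uq vpk.
have P2_gt0 := dot_gt0 p0.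
pose P := Num.sqrt (dot p p); have P_gt0 : 0 < P by rewrite sqrtr_gt0.
have PP : P ^+ 2 = dot p p by rewrite sqr_sqrtr // ltW.
have P0 : P != 0 by rewrite gt_eqF.
(* s is the determinant of the map under construction. *)
have [s s1 sE] : exists2 s : R, s ^+ 2 = 1 & s * cross u v k 0 = cross q p k 0.
  have : cross u v k 0 ^+ 2 = cross q p k 0 ^+ 2 by rewrite !cross_sqr // vp uq vpk.
  move=> /eqP; rewrite eqf_sqr => /orP[] /eqP ->; first by exists 1; rewrite ?expr1n ?mul1r.
  by exists (-1); rewrite ?sqrrN ?expr1n ?mulN1r ?opprK.
pose M x y (r : R) := frame_mx x (P^-1 *: y) ((P^-1 * r) *: cross x y).
have Mortho x y r : phase (x, y) -> dot y y = dot p p -> r ^+ 2 = 1 ->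
    (M x y r)^T *m M x y r = 1%:M.
  move=> xy yp r1; have [/= x1 xy0] := xy; apply: frame_mx_ortho;
    rewrite ?dotZl ?dotZr ?dotZl ?dot_cross ?(dotC x (cross _ _)) ?(dotC y (cross _ _))
      ?cross_dotl ?cross_dotr ?yp ?xy0 ?mulr0 // -PP; first by field.
  transitivity (r ^+ 2); last by [].
  by field.
have MM := Mortho _ _ 1 qp erefl (expr1n _ _).
have NN := Mortho _ _ s uv vp s1.
set A := M q p 1 in MM; set B := M u v s in NN.
have [Aq Ap _] := frame_mxE q (P^-1 *: p) ((P^-1 * 1) *: cross q p).
have [Bu Bv _] := frame_mxE u (P^-1 *: v) ((P^-1 * s) *: cross u v).
exists (B *m A^T).
  split.
    rewrite trmx_mul trmxK mulmxA -(mulmxA A) NN mulmx1.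
    exact: mulmx1C.
  have -> : B *m A^T *m delta_mx k 0 = B *m (B^T *m delta_mx k 0) :> 'cV[R]_3.
    (* The k-th rows are the coordinates of the axis in the two frames. *)
    have AB j : A k j = B k j.
      rewrite [LHS]mxE [RHS]mxE; have [->|->|->] := ord3P j => /=.
      - by rewrite uq.
      - by rewrite !mxE vpk.
      - by rewrite [LHS]mxE [RHS]mxE mulr1 -sE mulrA.
    rewrite -mulmxA; congr (_ *m _); rewrite -!colE; apply/colP => j.
    by rewrite 2![LHS]mxE 2![RHS]mxE AB.
  by rewrite mulmxA (mulmx1C NN) mul1mx.
have hq : B *m A^T *m q = u.
  by rewrite -[in LHS]Aq -/A mulmxA -(mulmxA B) MM mulmx1 Bu.
have hp : B *m A^T *m p = v.
  have -> : p = P *: (P^-1 *: p) by rewrite scalerA mulfV // scale1r.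
  rewrite -[in LHS]Ap -/A -scalemxAr mulmxA -(mulmxA B) MM mulmx1 Bv.
  by rewrite scalerA mulfV // scale1r.
by rewrite /diag_act /= hq hp.
Qed.

Lemma O2_dot k g u v : O2 R k g -> dot (g *m u) (g *m v) = dot u v.
Proof. by move=> [gg _]; rewrite /dot trmx_mul mulmxA -(mulmxA u^T) gg mulmx1. Qed.

Lemma O2_coord k g u : O2 R k g -> (g *m u) k 0 = u k 0.
Proof.
move=> gO; have [_ gk] := gO.
have dE w : dot (delta_mx k 0) w = w k 0 by rewrite /dot trmx_delta -rowE mxE.
by have := O2_dot (delta_mx k 0) u gO; rewrite gk !dE.
Qed.

Lemma O2_mul k g h : O2 R k g -> O2 R k h -> O2 R k (g *m h).
Proof.
move=> [gg gk] [hh hk]; split; last by rewrite -mulmxA hk.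
by rewrite trmx_mul mulmxA -(mulmxA h^T) gg mulmx1.
Qed.

Lemma O2_phase k g x : O2 R k g -> phase x -> phase (diag_act g x).
Proof. by move=> gk [x1 x2]; split => /=; rewrite (O2_dot _ _ gk). Qed.

Lemma group_orbit_invariant k (A : set ('cV[R]_3 * 'cV[R]_3)) :
  invariant_set (O2 R k) (group_orbit (O2 R k) A).
Proof.
move=> g _ gk [h [x [hk Ax ->]]]; exists (g *m h), x; split => //.
  exact: O2_mul.
by rewrite /diag_act /= !mulmxA.
Qed.

End axial_group.

Section axisymmetric_top.
Variables (R : realType) (J : 'rV[R]_3).
Hypothesis J_gt0 : forall i, 0 < J 0 i.
Local Notation X := ('cV[R]_3 * 'cV[R]_3)%type.
Local Notation phase := (cotangent_sphere R).
Variable k : 'I_3.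
Hypothesis Jsym : J 0 (k + 1) = J 0 (k + 2).
Hypothesis Jneq : J 0 (k + 1) != J 0 k.

Lemma axisymmetric_moment : moment J (k + 2) = moment J (k + 1).
Proof.
by have [e1 e2 e3 e4] := ord3_cyc k; rewrite /moment e1 e2 e3 e4 Jsym addrC.
Qed.

Lemma axisymmetric_moment_neq : moment J k - moment J (k + 1) != 0.
Proof.
have [e1 e2 e3 e4] := ord3_cyc k; rewrite /moment e1 e2.
rewrite (_ : _ - _ = J 0 (k + 1) - J 0 k); last by ring.
by rewrite subr_eq0.
Qed.

(** Both quadratic forms depend only on the length and on the k-th coordinate of
    their argument, and the group preserves these. *)
Lemma axisymmetric_energy g x : O2 R k g ->
  double_energy J (diag_act g x) = double_energy J x.
Proof.
move=> gO; have [e1 e2 e3 e4] := ord3_cyc k; have mE := axisymmetric_moment.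
have pE v : inertia_form J v = moment J (k + 1) * dot v v +
    (moment J k - moment J (k + 1)) * v k 0 ^+ 2.
  by rewrite /inertia_form (sum3 _ k) (dot3 v v k) mE; ring.
have qE v : adjugate_form J v = moment J k * moment J (k + 1) * dot v v +
    (moment J (k + 1) ^+ 2 - moment J k * moment J (k + 1)) * v k 0 ^+ 2.
  by rewrite /adjugate_form (sum3 _ k) (dot3 v v k) e1 e2 e3 e4 mE; ring.
by rewrite /double_energy /= !pE !qE !(O2_dot _ _ gO) !(O2_coord _ gO).
Qed.

Lemma orbit_level_stable (A : set X) (P2 : R) (i : 'I_3) :
  let S := group_orbit (O2 R k) A in
  S = [set x | [/\ phase x, dot x.2 x.2 = P2 & double_energy J x = P2 / moment J i]] ->
  group_Lyapunov_stable J (O2 R k) S.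
Proof.
move=> S SE; pose g : X -> R := cst 1.
have gc : continuous g by exact: cst_continuous.
have g0 x : phase x -> dot x.2 x.2 = P2 -> double_energy J x = P2 / moment J i -> g x != 0.
  by rewrite oner_eq0.
have SE' : S = [set x | [/\ phase x, dot x.2 x.2 = P2,
    double_energy J x = P2 / moment J i & 0 < g x]].
  by rewrite SE; apply/seteqP; split => x; [move=> [? ? ?]|move=> [? ? ? _]]; split.
have [Sc St] := energy_momentum_stability J_gt0 gc g0 SE'.
split => //; first by rewrite SE => x [].
  exact: group_orbit_invariant.
move=> U UN _; have [e [_ Vn Vc]] := St U UN.
exists (tube (energy_momentum_gap J P2 (P2 / moment J i)) g e); split => //.
move=> h x hO [px xe _]; split => //; first exact: (O2_phase hO px).
by rewrite /energy_momentum_gap (axisymmetric_energy _ hO) /= (O2_dot _ _ hO).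
Qed.

Section orbit_of_steady_rotation.
Variables (q p : R -> 'cV[R]_3) (n : 'cV[R]_3).
Hypothesis steady : steady_rotation J q p.
Hypothesis about : rotates_about n q p.
Hypothesis n0 : n != 0.

Let P2 := dot (p 0) (p 0).
Let S := group_orbit (O2 R k) (trajectory q p).
Let P20 : P2 != 0 := steady_momentum_neq0 J_gt0 steady.

Let ph t : phase (q t, p t).
Proof. by have [] := (proj1 steady) t I. Qed.

Let trajE : trajectory q p = [set x | phase x /\ cross x.1 x.2 = cross (q 0) (p 0)].
Proof. exact: (steady_trajectory J_gt0 steady about n0). Qed.

Let dot_p t : dot (p t) (p t) = P2 := steady_momentum J_gt0 steady t.

(** The k-th coordinates of q and p are invariant under the group; by
    [O2_connects] they form a complete set of invariants for a given |p|. *)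
Lemma group_orbitP (x : X) : S x <-> [/\ phase x, dot x.2 x.2 = P2 &
  exists t, x.1 k 0 = q t k 0 /\ x.2 k 0 = p t k 0].
Proof.
split => [[g [_ [gO [t _ <-] ->]]]|].
  split; first exact: (O2_phase gO (ph t)).
    by rewrite /= (O2_dot _ _ gO) dot_p.
  by exists t; rewrite /= !(O2_coord _ gO).
case: x => u v /= [uv vP [t [ut vt]]].
have pt0 : dot (p t) (p t) != 0 by rewrite dot_p.
have vpt : dot v v = dot (p t) (p t) by rewrite dot_p.
have [g gO ->] := O2_connects (ph t) uv pt0 vpt ut vt.
by exists g, (q t, p t); split => //; exists t.
Qed.

(** The two other moments agree, so the moment of the symmetry axis is strictly
    extremal.  The level consists of the rotations in both directions, which
    reflections exchange. *)
Lemma symmetry_axis_stable : (forall j, j != k -> n j 0 = 0) ->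
  group_Lyapunov_stable J (O2 R k) S.
Proof.
move=> nj; have qp0 := rotates_about_coord about n0 nj.
have [n1 n2 n3] := ord3_cyc_neq k.
have ext : (moment J (k + 1) <= moment J (k + 2) /\ moment J (k + 2) < moment J k) \/
    (moment J k < moment J (k + 2) /\ moment J (k + 2) <= moment J (k + 1)).
  rewrite axisymmetric_moment // lexx.
  have := axisymmetric_moment_neq; rewrite subr_eq0 neq_lt.
  by case/orP => h; [right|left].
have level u v : phase (u, v) -> dot v v = P2 ->
    double_energy J (u, v) = P2 / moment J k <-> u k 0 = 0 /\ v k 0 = 0.
  move=> uv vP; rewrite -vP; apply: (strict_extremum_level J_gt0 n1 n2 n3 ext uv).
  by rewrite vP.
apply: (orbit_level_stable (P2 := P2) (i := k)) => //; apply/seteqP; split => -[u v].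
  move=> /group_orbitP [uv vP [t [ut vt]]]; split => //; apply/level => //.
  by move: ut vt; have [-> ->] := qp0 t.
move=> [uv vP /(level _ _ uv vP)[uk vk]]; apply/group_orbitP; split => //; exists 0.
by have [-> ->] := qp0 0.
Qed.

(** For an axis orthogonal to the symmetry axis, [critical_identity] reduces to one
    square, and the level is the set where the plane of q and p contains the
    symmetry axis.  This is the group orbit of one great circle through that axis. *)
Lemma equatorial_axis_stable : n k 0 = 0 -> group_Lyapunov_stable J (O2 R k) S.
Proof.
move=> nk; have [e1 e2 e3 e4] := ord3_cyc k; have [n1 n2 n3] := ord3_cyc_neq k.
have mk t : cross (q t) (p t) k 0 = 0.
  have nE := steady_normal J_gt0 steady about t.
  move: (nk); rewrite nE mxE => /eqP; rewrite mulf_eq0 => /orP[/eqP c0|/eqP //].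
  by move: n0; rewrite nE c0 scale0r eqxx.
have level (u v : 'cV[R]_3) : phase (u, v) -> dot v v = P2 ->
    double_energy J (u, v) = P2 / moment J (k + 1) <-> cross u v k 0 = 0.
  move=> uv vP; rewrite -{1}vP critical_levelP //.
  have n1' : k + 1 != k by rewrite eq_sym.
  rewrite (critical_identity J n1' n3 n2 uv).
  rewrite axisymmetric_moment // subrr mul0r add0r; split => [/eqP|->].
    rewrite !mulf_eq0 (gt_eqF (moment_gt0 J_gt0 _)) -[_ - _ == 0]oppr_eq0 opprB.
    by rewrite (negbTE axisymmetric_moment_neq) /= orbb => /eqP.
  by rewrite expr0n mulr0.
apply: (orbit_level_stable (P2 := P2) (i := k + 1)) => //; apply/seteqP; split => x.
  move=> /group_orbitP [px xP [t [xt yt]]]; split => //.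
  case: x px xP xt yt => u v uv /= vP ut vt; apply/level => //.
  by apply/eqP; rewrite -sqrf_eq0 cross_sqr // ut vt vP -(dot_p t) -cross_sqr // mk expr0n.
move=> [px xP]; case: x px xP => u v uv /= vP /level => /(_ uv vP) uvk.
apply/group_orbitP; split => //=.
have [P [w [P_gt0 w0 PP qpE]]] := steady_circular J_gt0 steady about n0.
have P0 : P != 0 by rewrite gt_eqF.
(* The k-th coordinates of q and p / P form a point of the unit circle, which
   rotates uniformly along the steady motion. *)
have H (x y : 'cV[R]_3) : phase (x, y) -> dot y y = P2 -> cross x y k 0 = 0 ->
    (x k 0) ^+ 2 + (y k 0 / P) ^+ 2 = 1.
  move=> xy yP xyk; have := cross_sqr k xy; rewrite xyk yP expr0n /= /P2 -PP => h.
  apply: (mulIf (expf_neq0 2 P0)); rewrite mul1r.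
  transitivity (P ^+ 2 * x k 0 ^+ 2 + y k 0 ^+ 2); first by field.
  lra.
have H0 := H _ _ (ph 0) erefl (mk 0); have H1 := H _ _ uv vP uvk.
set a := q 0 k 0 in H0; set b := p 0 k 0 in H0.
(* The cosine and the sine of the angle between the two points. *)
have [||t [ct st]] := @circle_surj R w (a * u k 0 + b / P * (v k 0 / P))
  (b / P * u k 0 - a * (v k 0 / P)) => //.
  transitivity ((a ^+ 2 + (b / P) ^+ 2) * (u k 0 ^+ 2 + (v k 0 / P) ^+ 2)); first by ring.
  by rewrite H0 H1 mulr1.
exists t; have [-> ->] := qpE t; rewrite ct st !mxE -/a -/b; split.
  transitivity ((a ^+ 2 + (b / P) ^+ 2) * u k 0); first by rewrite H0 mul1r.
  by field.
transitivity ((a ^+ 2 + (b / P) ^+ 2) * v k 0); first by rewrite H0 mul1r.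
by field.
Qed.

End orbit_of_steady_rotation.

End axisymmetric_top.

(** * Principal axes and their moments *)

Lemma eigenvector_entry (R : realType) (J : 'rV[R]_3) (v : 'cV[R]_3) (a : R) :
  diag_mx J *m v = a *: v -> forall i, v i 0 != 0 -> J 0 i = a.
Proof.
move=> Jv i vi; have := congr1 (fun w : 'cV[R]_3 => w i 0) Jv.
by rewrite mul_diag_mx !mxE => /(mulIf vi).
Qed.

Lemma neq0_coord (R : realType) (v : 'cV[R]_3) : v != 0 -> exists i, v i 0 != 0.
Proof.
move=> v0; apply/existsP; apply: contraR v0 => /existsPn h.
by apply/eqP/colP => i; rewrite mxE; apply/eqP; have := h i; rewrite negbK.
Qed.

Lemma moment_of_coord_axis (R : realType) (J : 'rV[R]_3) (i : 'I_3) :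
  principal_axis J (delta_mx i 0) /\ principal_moment J (delta_mx i 0) (moment J i).
Proof.
have eig j : diag_mx J *m delta_mx j 0 = J 0 j *: delta_mx j 0 :> 'cV[R]_3.
  apply/colP => l; rewrite mul_diag_mx !mxE andbT.
  by case: eqP => [->|_] //; rewrite !mulr0.
have nz j : delta_mx j 0 != 0 :> 'cV[R]_3.
  by apply/eqP => /colP/(_ j); rewrite !mxE !eqxx => /eqP; rewrite oner_eq0.
have dd a b : a != b -> dot (delta_mx a 0) (delta_mx b 0) = 0 :> R.
  move=> ab; rewrite (dot_axis _ (i := a)); last by move=> j ja; rewrite mxE (negbTE ja).
  by rewrite !mxE (negbTE ab) mulr0.
have [n1 n2 n3] := ord3_cyc_neq i.
split; first by split; [exact: nz | exists (J 0 i)].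
exists (delta_mx (i + 1) 0), (delta_mx (i + 2) 0), (J 0 (i + 1)), (J 0 (i + 2)).
by split => //; split; exact: dd.
Qed.

Lemma principal_momentE (R : realType) (J : 'rV[R]_3) (n : 'cV[R]_3) (i : 'I_3) m :
  (forall j j', J 0 j = J 0 j' -> j = j') -> n != 0 -> (forall j, j != i -> n j 0 = 0) ->
  principal_moment J n m -> m = moment J i.
Proof.
move=> Jinj n0 nj [u [v [a [b [[u0 v0] [nu nv uv] Ju Jv ->]]]]].
have ni := axis_coord_neq0 n0 nj.
have [ui vi] : u i 0 = 0 /\ v i 0 = 0.
  move: nu nv; rewrite !(dot_axis _ nj) => /eqP + /eqP.
  by rewrite !mulf_eq0 !(negbTE ni) /= => /eqP -> /eqP ->.
have [j uj] := neq0_coord u0; have [l vl] := neq0_coord v0.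
have ij : i != j by apply: contra uj => /eqP <-; rewrite ui.
have il : i != l by apply: contra vl => /eqP <-; rewrite vi.
have uaxis h : h != j -> u h 0 = 0.
  move=> hj; apply/eqP; apply: contraR hj => uh.
  by apply/eqP/Jinj; rewrite (eigenvector_entry Ju uh) (eigenvector_entry Ju uj).
have jl : j != l.
  apply/eqP => jl; move/eqP: uv; rewrite (dot_axis _ uaxis) mulf_eq0 (negbTE uj) /=.
  by rewrite jl (negbTE vl).
rewrite -(eigenvector_entry Ju uj) -(eigenvector_entry Jv vl) /moment.
by have [[-> ->]|[-> ->]] := ord3_others ij il jl => //; rewrite addrC.
Qed.

Lemma principal_axis_distinct (R : realType) (J : 'rV[R]_3) (n : 'cV[R]_3) :
  (forall j j', J 0 j = J 0 j' -> j = j') -> principal_axis J n ->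
  exists i, forall j, j != i -> n j 0 = 0.
Proof.
move=> Jinj [n0 [a Jn]]; have [i ni] := neq0_coord n0; exists i => j.
apply: contraNeq => nj; apply/eqP/Jinj.
by rewrite (eigenvector_entry Jn nj) (eigenvector_entry Jn ni).
Qed.

Lemma not_axisymmetricP (R : realType) (J : 'rV[R]_3) : ~ axisymmetric J ->
  (forall i j, J 0 i = J 0 j) \/ (forall i j, J 0 i = J 0 j -> i = j).
Proof.
move=> nax.
have all3 i j k : i != j -> i != k -> j != k -> J 0 i = J 0 j -> J 0 i = J 0 k.
  move=> ij ik jk Jij; apply/eqP/negPn/negP => Jik; apply: nax; exists k, i, j.
  by split.
have [[i [j [ij Jij]]]|inj] := pselect (exists i j, i != j /\ J 0 i = J 0 j); last first.
  right => i j Jij; apply/eqP/negPn/negP => ij; apply: inj; by exists i, j.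
left; suff H l : J 0 l = J 0 i by move=> a b; rewrite !H.
have [->//|li] := eqVneq l i; have [->//|lj] := eqVneq l j.
by apply/esym/(all3 i j l) => //; rewrite eq_sym.
Qed.

Unset Implicit Arguments.

Theorem corollary3p13 (R : realType) (J : 'rV[R]_3) (J_gt0 : forall i, 0 < J 0 i)
    (q p : R -> 'cV[R]_3) (n : 'cV[R]_3) :
  steady_rotation J q p ->
  rotates_about n q p ->
  largest_principal_axis J n \/ smallest_principal_axis J n ->
  (~ axisymmetric J -> Lyapunov_stable J (trajectory q p)) /\
  (forall k : 'I_3, symmetry_index J k ->
     group_Lyapunov_stable J (O2 R k) (group_orbit (O2 R k) (trajectory q p))).
Proof.
move=> steady about extremal.
have nprin : principal_axis J n by case: extremal => -[].
have n0 : n != 0 by case: nprin.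
split=> [/not_axisymmetricP [Jc|Jinj]|k [i [j [ij ik jk Jij Jik]]]].
- exact: (spherical_stable J_gt0 steady about n0 Jc).
- have [i ni] := principal_axis_distinct Jinj nprin.
  have [n1 n2 n3] := ord3_cyc_neq i.
  have n3' : i + 2 != i + 1 by rewrite eq_sym.
  have st := strict_extremum_stable J_gt0 steady about n0.
  have mneq j : i != j -> moment J i != moment J j.
    move=> ij; apply/eqP => h; move/eqP: ij; apply; apply: Jinj.
    have tr l : moment J l = \sum_a J 0 a - J 0 l by rewrite (sum3 _ l) /moment; ring.
    by move: h; rewrite !tr => /addrI/oppr_inj.
  case: extremal => -[_ [m nm mext]]; rewrite (principal_momentE Jinj n0 ni nm) in mext.
  + have lt j : i != j -> moment J j < moment J i.
      have [ax mo] := moment_of_coord_axis J j.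
      by move=> ij; rewrite lt_neqAle (mext _ _ ax mo) andbT eq_sym mneq.
    have [h|/ltW h] := leP (moment J (i + 1)) (moment J (i + 2)).
      by apply: (st i (i + 1) (i + 2)) => //; left; rewrite h lt.
    by apply: (st i (i + 2) (i + 1)) => //; left; rewrite h lt.
  + have lt j : i != j -> moment J i < moment J j.
      have [ax mo] := moment_of_coord_axis J j.
      by move=> ij; rewrite lt_neqAle (mext _ _ ax mo) andbT mneq.
    have [h|/ltW h] := leP (moment J (i + 1)) (moment J (i + 2)).
      by apply: (st i (i + 2) (i + 1)) => //; right; rewrite h lt.
    by apply: (st i (i + 1) (i + 2)) => //; right; rewrite h lt.
- have [Jsym Jneq] : J 0 (k + 1) = J 0 (k + 2) /\ J 0 (k + 1) != J 0 k.
    rewrite eq_sym in ik; rewrite eq_sym in jk.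
    by have [[iE jE]|[iE jE]] := ord3_others ik jk ij; rewrite -iE -jE -?Jij.
  have [nk|nk] := eqVneq (n k 0) 0.
    exact: (equatorial_axis_stable J_gt0 Jsym Jneq steady about n0 nk).
  apply: (symmetry_axis_stable J_gt0 Jsym Jneq steady about n0) => l lk.
  have [_ [a Jn]] := nprin; apply/eqP; apply: contraR Jneq => nl.
  have Jlk : J 0 l = J 0 k by rewrite (eigenvector_entry Jn nl) (eigenvector_entry Jn nk).
  have [m1 m2 m3] := ord3_cyc_neq k.
  rewrite eq_sym in lk.
  have [<-//|l1] := eqVneq l (k + 1); first by rewrite Jlk.
  have [[lE _]|[lE _]] := ord3_others lk m1 l1; first by rewrite lE eqxx in l1.
  by rewrite Jsym -lE Jlk.
Qed.
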